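(* Let $\mathbf k$ be a field of characteristic $0$ and $V$ a graded $\mathbf k$-vector space. A homotopy Rota-Baxter system structure on $V$ is equivalent to a Maurer-Cartan element in the $L_\infty$-algebra $\mathfrak C_{\mathsf{RBS}}(V)$. In particular, when $V$ is concentrated in degree $0$, a Maurer-Cartan element in $\mathfrak C_{\mathsf{RBS}}(V)$ gives a Rota-Baxter system structure on $V$.
   Context: Gradings are homological; the Koszul sign rule is used throughout; $s$ denotes suspension, $(sV)_n=V_{n-1}$, and $\mathrm{End}_{sV}(n)=\mathrm{Hom}((sV)^{\otimes n},sV)$. **Rota-Baxter systems.** A Rota-Baxter system structure on a vector space $V$ is an associative product $\mu$ on $V$ with linear maps $R,S:V\to V$ such that $R(a)R(b)=R(R(a)b+aS(b))$ and $S(a)S(b)=S(R(a)b+aS(b))$ for all $a,b$. **Homotopy Rota-Baxter systems.** A homotopy Rota-Baxter system on a graded space $V$ consists of graded maps $m_n,R_n,S_n:V^{\otimes n}\to V$, $n\ge1$, $|m_n|=n-2$, $|R_n|=|S_n|=n-1$, such that for all $n\geq 1$ $$\sum_{\substack{i+j+k=n\\ i,k\ge0,\,j\ge1}}(-1)^{i+jk}m_{i+1+k}\circ(\mathrm{id}^{\otimes i}\otimes m_j\otimes\mathrm{id}^{\otimes k})=0,$$ $$\sum_{k=1}^n\sum_{\substack{l_1+\cdots+l_k=n\\ l_t\ge1}}(-1)^{\delta}m_k\circ(X_{l_1}\otimes\cdots\otimes X_{l_k})=\sum_{1\le j\le p\le n}\ \sum_{\substack{r_1+\cdots+r_p=n\\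 r_t\ge1}}\ \sum_{\substack{i+1+k=r_1\\ i,k\geq0}}(-1)^{\eta}X_{r_1}\circ\Big(\mathrm{id}^{\otimes i}\otimes m_p\circ(R_{r_2}\otimes\cdots\otimes R_{r_j}\otimes\mathrm{id}\otimes S_{r_{j+1}}\otimes\cdots\otimes S_{r_p})\otimes\mathrm{id}^{\otimes k}\Big)$$ both for $X=R$ and for $X=S$, where $\delta=\frac{k(k-1)}2+\sum_{t=1}^k(k-t)l_t$ and $\eta=i+\big(p+\sum_{t=2}^p(r_t-1)\big)k+\sum_{t=2}^j(r_t-1)+\sum_{t=2}^p(r_t-1)(p-t)$. **The homotopy cooperad $\mathscr S$.** $\mathscr S(n)=\mathbf ku_n\oplus\mathbf kv_n\oplus\mathbf kw_n$ ($n\ge1$), $|u_n|=0$, $|v_n|=|w_n|=1$. For a planar rooted tree $T$ (all vertices with at least one input; weight $|T|$ = number of vertices), $\mathscr S^{\otimes T}$ is the tensor product of the $\mathscr S(\text{arity})$ over the vertices in planar (depth-first, left to right) order. The structure maps $\Delta_T:\mathscr S(n)\to\mathscr S^{\otimes T}$ have degree $|T|-2$ and are zero except: (I) $T$ has a root of arity $n-j+1$ with a vertex of arity $j$ grafted at input $i$ ($1\le j\le n$, $1\le i\le n-j+1$): $\Delta_T(u_n)=u_{n-j+1}\otimes u_j$; for $n\ge2$ and $x\in\{v,w\}$, $\Delta_T(x_n)=x_n\otimes u_1$ if $j=1$ and $u_1\otimes x_n$ if $j=n$; for $n=1$, $\Delta_T(x_1)=x_1\otimes u_1+u_1\otimes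 x_1$. (II) $T$ has a root of arity $k\ge2$ with vertices of arities $r_1,\dots,r_k\ge1$ grafted on all its inputs, $r_1+\dots+r_k=n$: $\Delta_T(x_n)=(-1)^{k(k-1)/2}u_k\otimes x_{r_1}\otimes\cdots\otimes x_{r_k}$ for $x\in\{v,w\}$. (III) $T$ has a root of arity $r_1$, a vertex of arity $p\ge2$ grafted on the $i$-th input of the root, and vertices of arities $r_2,\dots,r_j,r_{j+1},\dots,r_p$ grafted on inputs $1,\dots,j-1,j+1,\dots,p$ of the latter (its $j$-th input being a leaf), $r_1+\dots+r_p=n$, $r_t\geq 1$: $\Delta_T(x_n)=(-1)^{p(p-1)/2}x_{r_1}\otimes u_p\otimes v_{r_2}\otimes\cdots\otimes v_{r_j}\otimes w_{r_{j+1}}\otimes\cdots\otimes w_{r_p}$ for $x\in\{v,w\}$. **The $L_\infty$-algebra $\mathfrak C_{\mathsf{RBS}}(V)$.** It is the convolution $L_\infty$-algebra with underlying graded space $\prod_{n\ge1}\mathrm{Hom}(\mathscr S(n),\mathrm{End}_{sV}(n))$. Its $L_\infty$-structure, expressed as graded-symmetric brackets $\lambda_m$ ($m\ge1$) of degree $-1$ on its suspension $W=\prod_{n\ge1}\mathrm{Hom}(s^{-1}\mathscr S(n),\mathrm{End}_{sV}(n))$, is $$\lambda_m(\varphi_1,\dots,\varphi_m)(s^{-1}c)=(-1)^{1+\sum_i|\varphi_i|}\sum_{|T|=m}\sum_{\sigma\in\mathbb S_m}\varepsilon(\sigma)\,\gamma_T\Big((\varphi_{\sigma(1)}\otimes\cdots\otimes\varphi_{\sigma(m)})\big((s^{-1})^{\otimes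 m}\Delta_T(c)\big)\Big),$$ where $\varepsilon(\sigma)$ is the Koszul sign of the permutation, the $k$-th factor is placed at the $k$-th vertex of $T$ in planar order, and $\gamma_T$ is operadic composition in $\mathrm{End}_{sV}$ along $T$. A Maurer-Cartan element is a degree $-1$ element of $\mathfrak C_{\mathsf{RBS}}(V)$, i.e. a degree $0$ element $\varphi\in W$, with $\sum_{m\ge1}\frac1{m!}\lambda_m(\varphi,\dots,\varphi)=0$ (the sum is finite in each component). ''Equivalent'' refers to the (de)suspension correspondence $m_n=s^{-1}\circ\varphi(s^{-1}u_n)\circ s^{\otimes n}$, $R_n=s^{-1}\circ\varphi(s^{-1}v_n)\circ s^{\otimes n}$, $S_n=s^{-1}\circ\varphi(s^{-1}w_n)\circ s^{\otimes n}$ between families of maps on $V$ and degree $0$ elements $\varphi$ of $W$. *)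

(* Defs.v *)
From HB Require Import structures.
From mathcomp Require Import all_boot all_order all_algebra all_fingroup.
From mathcomp Require Import zify.
Set Implicit Arguments.
Unset Strict Implicit.
Unset Printing Implicit Defensive.
Import GRing.Theory.
Local Open Scope ring_scope.

(** A graded space is a family of vector spaces indexed by the homological
    degree.  A homogeneous element of [V] is a pair of a degree [d] and an
    element of [V d]; in particular each degree has its own zero. *)

Definition gspace (K : fieldType) := int -> lmodType K.

Definition homog (K : fieldType) (V : gspace K) := {d : int & V d}.

Definition Homog (K : fieldType) (V : gspace K) (d : int) (v : V d) : homog V :=
  existT _ d v.

Definition hdeg (K : fieldType) (V : gspace K) (x : homog V) : int := tag x.

Definition sdeg (K : fieldType) (V : gspace K) (xs : seq (homog V)) : int :=
  \sum_(x <- xs) hdeg x.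

Definition hcomp (K : fieldType) (V : gspace K) (b : int) (x : homog V) : V b :=
  untag (0 : V b) (fun v : V b => v) x.

(** Raw operations [V^{(x)n} -> W] of a given arity and degree: the value on a
    list of homogeneous elements is given by its components in all degrees [b]
    of [W].  Linearity and homogeneity are imposed in [gmap]. *)
Record op (K : fieldType) (V W : gspace K) := Op {
  oar : nat;
  odg : int;
  oval :> seq (homog V) -> forall b : int, W b }.

(** [gmap V W n d] is the space of degree [d] linear maps [V^{(x)n} -> W].  The
    values outside of arity [n], or in an output degree other than the sum of
    the input degrees plus [d], are required to vanish, so that a [gmap] carries
    no information besides the linear map. *)
Record gmap (K : fieldType) (V W : gspace K) (n : nat) (d : int) := GMap {
  gval : seq (homog V) -> forall b : int, W b;
  gval_supp : forall xs b,
    (size xs != n) || (b != sdeg xs + d) -> gval xs b = 0;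
  gval_linear : forall (xs ys : seq (homog V)) (e : int) (a : K) (u v : V e) b,
    gval (xs ++ Homog (a *: u + v) :: ys) b =
      a *: gval (xs ++ Homog u :: ys) b + gval (xs ++ Homog v :: ys) b }.

Definition op_of_gmap (K : fieldType) (V W : gspace K) (n : nat) (d : int)
  (f : gmap V W n d) : op V W := Op n d (gval f).
Coercion op_of_gmap : gmap >-> op.

(** Exponent of the Koszul sign in
    [(f_1 (x) ... (x) f_k)(x_1 (x) ... (x) x_k)
       = +- f_1(x_1) (x) ... (x) f_k(x_k)],
    namely the sum of [|f_j| |x_i|] over [i < j], where [ds] lists the [|f_j|]
    and [es] the [|x_i|]. *)
Fixpoint kexp (ds es : seq int) : int :=
  match ds, es with
  | _ :: ds', e :: es' => (\sum_(d <- ds') d) * e + kexp ds' es'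
  | _, _ => 0
  end.

Definition gcomp (K : fieldType) (U V W : gspace K)
    (f : op V W) (gs : seq (op U V)) : op U W :=
  let ar := sumn (map (@oar K U V) gs) in
  let dg := odg f + \sum_(g <- gs) odg g in
  Op ar dg (fun xs b =>
    let blocks := reshape (map (@oar K U V) gs) xs in
    if size xs == ar then
      (-1) ^ (kexp (map (@odg K U V) gs) (map (@sdeg K U) blocks))
        *: f [seq Homog (oval p.1 p.2 (sdeg p.2 + odg p.1)) | p <- zip gs blocks] b
    else 0).

Definition idop (K : fieldType) (V : gspace K) : op V V :=
  Op 1 0 (fun xs b => if xs is [:: x] then hcomp b x else 0).

(** [(sV)_n = V_{n-1}], with the suspension [s : V -> sV] of degree 1 and its
    inverse [s^-1 : sV -> V] of degree -1. *)
Definition susp (K : fieldType) (V : gspace K) : gspace K :=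
  fun n => V (n - 1).

Definition sop (K : fieldType) (V : gspace K) : op V (susp V) :=
  Op 1 1 (fun xs b => if xs is [:: x] then hcomp (b - 1) x : susp V b else 0).

Definition sinvop (K : fieldType) (V : gspace K) : op (susp V) V :=
  Op 1 (-1) (fun xs b =>
    if xs is [:: x] then hcomp b (Homog (tagged x : V (hdeg x - 1))) else 0).

Fixpoint compositions (k n : nat) : seq (seq nat) :=
  if k is k'.+1 then
    [seq a :: r | a <- iota 1 n, r <- compositions k' (n - a)]
  else if n == 0%N then [:: [::]] else [::].

Lemma mem_compositions k n r :
  (r \in compositions k n) =
    [&& size r == k, all (leq 1) r & sumn r == n].
Proof.
elim: k n r => [|k IHk] n r /=.
  by case: r => [|a r]; case: n => [|n] //=; rewrite ?in_nil.
apply/allpairsPdep/idP => [[a [r' [+ + ->]]]|].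
  rewrite mem_iota IHk /= => /andP[a1 an] /and3P[/eqP-> -> /eqP->].
  rewrite eqxx a1 /=; apply/eqP; lia.
case: r => [|a r] //= /and3P[]; rewrite eqSS => sr /andP[a1 r1] /eqP sn.
exists a, r; rewrite mem_iota IHk sr r1; split=> //=; first by lia.
apply/eqP; lia.
Qed.

Lemma uniq_compositions k n : uniq (compositions k n).
Proof.
elim: k n => [|k IHk] n /=; first by case: ifP.
apply: allpairs_uniq_dep => [|a _|]; [exact: iota_uniq | exact: IHk |].
by case=> [a r] [a' r'] _ _ /= [-> ->].
Qed.

(** Everywhere below a family indexed by the arities [n >= 1] is a
    function on [nat] whose value at [n] is the component of arity [n.+1]. *)
Record hrbs_data (K : fieldType) (V : gspace K) := HRBSData {
  hm : forall n : nat, gmap V V n.+1 (n.+1%:Z - 2);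
  hR : forall n : nat, gmap V V n.+1 (n.+1%:Z - 1);
  hS : forall n : nat, gmap V V n.+1 (n.+1%:Z - 1) }.

Definition mop (K : fieldType) (V : gspace K) (F : hrbs_data V) (n : nat) :
  op V V := hm F n.-1.
Definition Rop (K : fieldType) (V : gspace K) (F : hrbs_data V) (n : nat) :
  op V V := hR F n.-1.
Definition Sop (K : fieldType) (V : gspace K) (F : hrbs_data V) (n : nat) :
  op V V := hS F n.-1.

(** 1-based access: [part r t] is [r_t]. *)
Definition part (r : seq nat) (t : nat) : nat := nth 0%N r t.-1.

Definition delta_exp (k : nat) (l : seq nat) : nat :=
  ((k * (k - 1))./2 + \sum_(1 <= t < k.+1) (k - t) * part l t)%N.

Definition eta_exp (i k p j : nat) (r : seq nat) : nat :=
  (i + (p + \sum_(2 <= t < p.+1) (part r t - 1)) * k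
   + \sum_(2 <= t < j.+1) (part r t - 1)
   + \sum_(2 <= t < p.+1) (part r t - 1) * (p - t))%N.

Definition stasheff (K : fieldType) (V : gspace K) (m : nat -> op V V) :=
  forall n : nat, (1 <= n)%N -> forall (xs : seq (homog V)) (b : int),
    \sum_(i < n.+1) \sum_(j < n.+1) \sum_(k < n.+1 | (i + j + k == n)%N && (1 <= j)%N)
      (-1) ^+ (i + j * k)
        *: gcomp (m (i + 1 + k)%N)
             (nseq i (idop V) ++ m j :: nseq k (idop V)) xs b
    = 0.

Definition rb_identity (K : fieldType) (V : gspace K) (m R S X : nat -> op V V) :=
  forall n : nat, (1 <= n)%N -> forall (xs : seq (homog V)) (b : int),
    \sum_(1 <= k < n.+1) \sum_(l <- compositions k n)
      (-1) ^+ delta_exp k l *: gcomp (m k) (map X l) xs b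
    =
    \sum_(1 <= p < n.+1) \sum_(1 <= j < p.+1) \sum_(r <- compositions p n)
      \sum_(i < part r 1)
        let k := (part r 1 - 1 - i)%N in
        let inner :=
          gcomp (m p) (map R (take j.-1 (behead r)) ++
                      idop V :: map S (drop j.-1 (behead r))) in
        (-1) ^+ eta_exp i k p j r
          *: gcomp (X (part r 1))
               (nseq i (idop V) ++ inner :: nseq k (idop V)) xs b.

Definition is_hrbs (K : fieldType) (V : gspace K) (F : hrbs_data V) : Prop :=
  [/\ stasheff (mop F),
      rb_identity (mop F) (Rop F) (Sop F) (Rop F)
    & rb_identity (mop F) (Rop F) (Sop F) (Sop F)].

Definition is_rb_system (K : fieldType) (A : lmodType K)
    (mu : A -> A -> A) (R S : A -> A) : Prop :=
  [/\ [/\ forall a x y z, mu (a *: x + y) z = a *: mu x z + mu y z,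
          forall a x y z, mu z (a *: x + y) = a *: mu z x + mu z y
        & associative mu],
      (forall a x y, R (a *: x + y) = a *: R x + R y) /\
      (forall a x y, S (a *: x + y) = a *: S x + S y),
      forall a b, mu (R a) (R b) = R (mu (R a) b + mu a (S b))
    & forall a b, mu (S a) (S b) = S (mu (R a) b + mu a (S b))].

(** [Leaf] is an input edge, [Node ts] a vertex of arity [size ts].  Vertices
    without inputs are excluded by [wf_tree]. *)
Inductive tree := Leaf | Node of seq tree.

Definition tree_nested_ind (P : tree -> Prop) (PL : P Leaf)
    (PN : forall ts, foldr (fun t Q => P t /\ Q) True ts -> P (Node ts)) :=
  fix loop t : P t :=
    match t with
    | Leaf => PL
    | Node ts =>
      PN ts ((fix loops ts : foldr (fun t Q => P t /\ Q) True ts :=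
        if ts is t :: ts' then conj (loop t) (loops ts') else I) ts)
    end.

Fixpoint tree_encode (t : tree) : GenTree.tree unit :=
  match t with
  | Leaf => GenTree.Leaf tt
  | Node ts => GenTree.Node 0 (map tree_encode ts)
  end.

Fixpoint tree_decode (t : GenTree.tree unit) : tree :=
  match t with
  | GenTree.Leaf _ => Leaf
  | GenTree.Node _ ts => Node (map tree_decode ts)
  end.

Lemma tree_encodeK : cancel tree_encode tree_decode.
Proof.
elim/tree_nested_ind => //= ts IH; congr Node.
by elim: ts IH => //= t ts IHts [-> /IHts ->].
Qed.

HB.instance Definition _ := Countable.copy tree (can_type tree_encodeK).

Fixpoint wf_tree (t : tree) : bool :=
  if t is Node ts then (ts != [::]) && all wf_tree ts else true.

Fixpoint leaves (t : tree) : nat :=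
  if t is Node ts then sumn (map leaves ts) else 1.

(** In planar (depth-first, left to right) order. *)
Fixpoint arities (t : tree) : seq nat :=
  if t is Node ts then size ts :: flatten (map arities ts) else [::].

Definition weight (t : tree) : nat := size (arities t).

Fixpoint lists_of (T : Type) (s : seq T) (k : nat) : seq (seq T) :=
  if k is k'.+1 then [seq x :: l | x <- s, l <- lists_of s k'] else [:: [::]].

(** Height at most [h], arities in [1..n]. *)
Fixpoint bounded_trees (n h : nat) : seq tree :=
  if h is h'.+1 then
    Leaf :: [seq Node ts | k <- iota 1 n, ts <- lists_of (bounded_trees n h') k]
  else [:: Leaf].

(** A tree with [m] vertices and [n] leaves has height at most [m] and arities at
    most [n]: see [mem_trees]. *)
Definition trees (m n : nat) : seq tree :=
  undup [seq t <- bounded_trees n m | (weight t == m) && (leaves t == n)].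

Lemma mem_lists_of (T : eqType) (s : seq T) k l :
  (l \in lists_of s k) = (size l == k) && all (mem s) l.
Proof.
elim: k l => [|k IHk] l /=; first by case: l.
apply/allpairsP/idP => [[[x l'] /= [xs + ->]]|].
  by rewrite IHk /= => /andP[/eqP-> ->]; rewrite eqxx xs.
case: l => [|x l] //= /and3P[]; rewrite eqSS => sl xs ls.
by exists (x, l); rewrite IHk sl ls.
Qed.

Lemma weight_Node ts : weight (Node ts) = (sumn (map weight ts)).+1.
Proof. by rewrite /weight /= size_flatten /shape -map_comp. Qed.

Lemma leaves_gt0 t : wf_tree t -> (0 < leaves t)%N.
Proof.
elim/tree_nested_ind: t => //= -[|t ts] //= [IH _] /andP[/IH lt _].
exact: ltn_addr.
Qed.

Lemma wf_bounded n h t : t \in bounded_trees n h -> wf_tree t.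
Proof.
elim: h t => [|h IHh] t /=; first by rewrite inE => /eqP->.
rewrite inE => /orP[/eqP-> //|/allpairsPdep[k [ts [+ + ->]]]].
rewrite mem_iota mem_lists_of => /andP[k1 _] /andP[/eqP sk /allP ats] /=.
apply/andP; split; last by apply/allP => x /ats; exact: IHh.
by rewrite -size_eq0 sk -lt0n.
Qed.

Lemma bounded_complete n h t :
  wf_tree t -> (weight t <= h)%N -> (leaves t <= n)%N -> t \in bounded_trees n h.
Proof.
elim: h t => [|h IHh] [|ts] //; rewrite weight_Node // ltnS.
move=> /= /andP[ts0 wts] wh ln; rewrite inE /=.
apply/allpairsPdep; exists (size ts), ts; split=> //.
  rewrite mem_iota lt0n size_eq0 ts0 add1n ltnS /=; apply: leq_trans ln.
  elim: ts wts {ts0 wh} => //= t ts IH /andP[/leaves_gt0 lt /IH].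
  by rewrite -add1n => /(leq_add lt).
rewrite mem_lists_of eqxx /=; apply/allP => t tts /=.
have le_sumn (f : tree -> nat) : (f t <= sumn (map f ts))%N.
  elim: ts tts {ts0 wts wh ln} => //= t' ts IH; rewrite inE => /orP[/eqP->|/IH].
    exact: leq_addr.
  by move/leq_trans; apply; exact: leq_addl.
apply: IHh; first exact: (allP wts).
- exact: leq_trans (le_sumn weight) wh.
- exact: leq_trans (le_sumn leaves) ln.
Qed.

Lemma mem_trees m n t :
  (t \in trees m n) = [&& wf_tree t, weight t == m & leaves t == n].
Proof.
rewrite mem_undup mem_filter andbC; apply/andP/and3P.
  by case=> /wf_bounded -> /andP[].
by case=> wt /[dup] wm -> /[dup] ln ->; split=> //; apply: bounded_complete;
  rewrite // (eqP wm, eqP ln).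
Qed.

Lemma uniq_trees m n : uniq (trees m n).
Proof. exact: undup_uniq. Qed.

(** The basis [u_n], [v_n], [w_n] of the n-th component. *)
Inductive gen := gu | gv | gw.

Definition gdeg (c : gen) : int := if c is gu then 0 else 1.

Definition corolla (j : nat) : tree := Node (nseq j Leaf).

(** [i] and [j] are 1-based positions. *)
Definition treeI (n j i : nat) : tree :=
  Node (nseq i.-1 Leaf ++ corolla j :: nseq (n - j + 1 - i) Leaf).

Definition treeII (r : seq nat) : tree := Node (map corolla r).

Definition treeIII (r : seq nat) (j i : nat) : tree :=
  let rs := behead r in
  Node (nseq i.-1 Leaf ++
        Node (map corolla (take j.-1 rs) ++ Leaf :: map corolla (drop j.-1 rs))
        :: nseq (part r 1 - i) Leaf).

(** [Delta n T c] is the value on the basis element [c] of arity [n] of the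
    structure map indexed by [T], as a formal linear combination: a pair
    [(a, cs)] stands for [a] times the tensor product of the basis elements [cs]
    placed at the vertices of [T] in planar order (their arities being those of
    the vertices).  The shapes I, II, III are pairwise distinct for distinct
    parameters, so that for a given [T] at most one choice of the parameters
    contributes.  In type I the case [n = 1] is the one where [j = 1] and
    [j = n] both hold. *)
Definition DeltaI (K : fieldType) (n : nat) (T : tree) (c : gen) :
    seq (K * seq gen) :=
  flatten [seq
    if T == treeI n j i then
      if c is gu then [:: (1, [:: gu; gu])]
      else (if j == 1%N then [:: (1, [:: c; gu])] else [::]) ++
           (if j == n then [:: (1, [:: gu; c])] else [::])
    else [::]
  | j <- iota 1 n, i <- iota 1 (n - j + 1)].

Definition DeltaII (K : fieldType) (n : nat) (T : tree) (c : gen) :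
    seq (K * seq gen) :=
  if c is gu then [::] else
  flatten [seq
    if T == treeII r then [:: ((-1) ^+ (k * (k - 1))./2, gu :: nseq k c)]
    else [::]
  | k <- iota 2 n.-1, r <- compositions k n].

Definition DeltaIII (K : fieldType) (n : nat) (T : tree) (c : gen) :
    seq (K * seq gen) :=
  if c is gu then [::] else
  flatten (flatten [seq [seq
    if T == treeIII r j i then
      [:: ((-1) ^+ (p * (p - 1))./2,
           [:: c, gu & nseq j.-1 gv ++ nseq (p - j) gw])]
    else [::]
  | j <- iota 1 p, i <- iota 1 (part r 1)]
  | p <- iota 2 n.-1, r <- compositions p n]).

Definition Delta (K : fieldType) (n : nat) (T : tree) (c : gen) :
    seq (K * seq gen) :=
  DeltaI K n T c ++ DeltaII K n T c ++ DeltaIII K n T c.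

(** Elements of degree [e] of the product over [n >= 1] of the spaces
    [Hom(s^-1 S(n), End_sV(n))], given by their values on the basis: [phi n c] is
    the image of [s^-1 c], for [c] of arity [n.+1]. *)
Definition welem (K : fieldType) (V : gspace K) (e : int) :=
  forall (n : nat) (c : gen), gmap (susp V) (susp V) n.+1 (gdeg c - 1 + e).

Definition whomog (K : fieldType) (V : gspace K) := {e : int & welem V e}.

(** The value on [s^-1 c], for [c] of arity [n]; only used for [n >= 1]. *)
Definition wop (K : fieldType) (V : gspace K) (phi : whomog V)
  (n : nat) (c : gen) : op (susp V) (susp V) := tagged phi n.-1 c.

(** Composition in the endomorphism operad along a tree, [fs] being placed at the
    vertices in planar order.  This order is the one of
    [f_root (x) (factors of T_1) (x) ... (x) (factors of T_k)], so the only signs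
    are those of [gcomp]. *)
Fixpoint treecomp (K : fieldType) (V : gspace K) (T : tree) (fs : seq (op V V)) :
    op V V :=
  match T with
  | Leaf => idop V
  | Node ts =>
    if fs is f :: fs' then
      gcomp f
        ((fix branches (ts : seq tree) (fs : seq (op V V)) : seq (op V V) :=
            if ts is t :: ts' then
              treecomp t (take (weight t) fs) ::
                branches ts' (drop (weight t) fs)
            else [::]) ts fs')
    else idop V
  end.

(** Koszul sign of the permutation
    [x_1 (x) ... (x) x_m |-> x_{s 1} (x) ... (x) x_{s m}], with [e i = |x_i|]. *)
Definition koszul (K : fieldType) (m : nat) (e : 'I_m -> int) (s : 'S_m) : K :=
  \prod_(i < m) \prod_(j < m | (i < j)%N && (s j < s i)%N)
    (-1) ^ (e (s i) * e (s j)).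

(** [gamma_T ((phis_1 (x) ... (x) phis_m) ((s^-1)^{(x)m} (cs_1 (x) ... (x) cs_m)))]:
    the first sign comes from applying [(s^-1)^{(x)m}], the second one from
    applying [phis_1 (x) ... (x) phis_m]. *)
Definition conv_term (K : fieldType) (V : gspace K) (T : tree)
    (phis : seq (whomog V)) (cs : seq gen) (xs : seq (homog (susp V))) (b : int) :
    susp V b :=
  (-1) ^ (kexp (nseq (size phis) (-1)) (map gdeg cs))
  *: ((-1) ^ (kexp (map (fun phi => tag phi) phis)
                   (map (fun c => gdeg c - 1) cs))
  *: treecomp T
       [seq wop q.1 q.2.1 q.2.2 | q <- zip phis (zip (arities T) cs)] xs b).

(** The bracket [lambda_m(phi_1, ..., phi_m)], evaluated on [s^-1 c] with [c] of
    arity [n]. *)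
Definition lambda (K : fieldType) (V : gspace K) (m : nat)
    (phi : 'I_m -> whomog V) (n : nat) (c : gen)
    (xs : seq (homog (susp V))) (b : int) : susp V b :=
  (-1) ^ (1 + \sum_(i < m) tag (phi i)) *:
  \sum_(T <- trees m n) \sum_(s : 'S_m)
    koszul K (fun i => tag (phi i)) s *:
    \sum_(t <- Delta K n T c)
      t.1 *: conv_term T [seq phi (s i) | i <- enum 'I_m] t.2 xs b.

(** The sum over [m] is finite in each component: its partial sums are eventually
    constant, and the Maurer-Cartan equation says that they are eventually 0. *)
Definition is_MC (K : fieldType) (V : gspace K) (phi : welem V 0) : Prop :=
  forall (n : nat) (c : gen), (1 <= n)%N ->
    exists M : nat, forall N : nat, (M <= N)%N ->
      forall (xs : seq (homog (susp V))) (b : int),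
        \sum_(1 <= m < N.+1)
          (m`!%:R)^-1 *: lambda (fun _ : 'I_m => existT _ 0 phi : whomog V) n c xs b
        = 0.

Definition desusp (K : fieldType) (V : gspace K) (f : op (susp V) (susp V)) :
    op V V :=
  gcomp (gcomp (sinvop V) [:: f]) (nseq (oar f) (sop V)).

Definition corresponds (K : fieldType) (V : gspace K)
    (phi : welem V 0) (F : hrbs_data V) : Prop :=
  forall (n : nat) (xs : seq (homog V)) (b : int),
    [/\ gval (hm F n) xs b = desusp (phi n gu) xs b,
        gval (hR F n) xs b = desusp (phi n gv) xs b
      & gval (hS F n) xs b = desusp (phi n gw) xs b].

Definition concentrated_in_degree0 (K : fieldType) (V : gspace K) : Prop :=
  forall d : int, d != 0 -> forall v : V d, v = 0.

(* Main.v *)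
(** For a degree 0 element the sum over permutations cancels the factorials (this
    is where characteristic 0 enters), so the Maurer-Cartan equation says that
    the sum over trees of the compositions of [b_n = phi(s^-1 u_n)] and
    [f_n = phi(s^-1 x_n)], [x = v, w], vanishes.  The Koszul signs of
    [(s^-1)^{(x)m}] cancel those in the structure maps of type II, and leave
    [-1] in type III, so that what remains is [sum b(1 (x) b (x) 1) = 0] on [u_n] and, on [x_n],
    [sum b_k(f (x) ... (x) f)
       = sum f(1 (x) b_p(f_v (x) ... (x) 1 (x) ... (x) f_w) (x) 1)].
    Since [b_n] has degree -1 and the [f_n] have degree 0, all the signs
    [delta], [eta] and [i + jk] come from moving the suspensions through the
    maps of [V] when these equations are desuspended. *)

Require Import Defs.
From mathcomp Require Import all_boot all_order all_algebra.
From mathcomp Require Import perm zify ring.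
From Stdlib Require Import FunctionalExtensionality ProofIrrelevance.
Import GRing.Theory.
Local Open Scope ring_scope.

Set Implicit Arguments.
Unset Strict Implicit.
Unset Printing Implicit Defensive.

(** * Desuspension of operations *)

(** The obstacle is that each Koszul sign in a composite depends on the degrees of the arguments,
    while [delta], [eta] and [i + jk] do not. The pivot is that the relation
    [P = (-1)^e s^-1 Q s^{(x)n}] with a constant [e] is stable under composition: the
    argument-dependent parts cancel modulo 2. A composite along a tree therefore desuspends with an
    exponent read off from degrees and arities alone, and every term of an equation acquires the
    same invertible factor [(-1)^(susp_exp ys)]. The prescribed signs are exactly these constant
    exponents modulo 2. *)

Section Desuspension.

Variables (K : fieldType) (V : gspace K).
Local Notation sV := (susp V).

Lemma hcompE (W : gspace K) d (v : W d) : hcomp d (Homog v) = v.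
Proof.
have e : tag (Homog v) = d by [].
by rewrite /hcomp (untagE _ _ e) (eq_irrelevance e (erefl d)).
Qed.

Lemma hcomp_neq (W : gspace K) b (x : homog W) : hdeg x != b -> hcomp b x = 0.
Proof. exact: untag_dflt. Qed.

Lemma Homog_hcomp (W : gspace K) b (x : homog W) :
  hdeg x = b -> Homog (hcomp b x) = x.
Proof. by case: x => d v /= <-; rewrite hcompE. Qed.

(** Congruence modulo 2 is certified by an explicit half-difference [c], so that each sign
    comparison becomes an integer identity for [ring] or [lia]. *)
Lemma signz_even (a b c : int) : a = b + 2 * c -> (-1) ^ a = (-1) ^ b :> K.
Proof.
move=> ->; rewrite expfzDr ?oppr_eq0 ?oner_eq0 // -exprz_exp.
by rewrite -[2]/(2%:Z) -exprnP sqrrN expr1n exp1rz mulr1.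
Qed.

Lemma signzD (a b : int) : (-1) ^ (a + b) = (-1) ^ a * (-1) ^ b :> K.
Proof. by rewrite expfzDr ?oppr_eq0 ?oner_eq0. Qed.

Lemma signz_neq0 (a : int) : (-1) ^ a != 0 :> K.
Proof. by rewrite expfz_neq0 ?oppr_eq0 ?oner_eq0. Qed.

(** [susp V d] is [V (d - 1)] by conversion, so [s^-1] only retypes the vector. *)
Definition desusp_elem (y : homog sV) : homog V :=
  Homog (tagged y : V (hdeg y - 1)).

Local Notation dn := desusp_elem.

Lemma hdeg_dn y : hdeg (dn y) = hdeg y - 1. Proof. by []. Qed.

Lemma dn_surj x : exists y, dn y = x.
Proof.
(* [d] is replaced by [e - 1] before the vector is introduced, because [V d] and [V (d + 1 - 1)] are
   not convertible. *)
case: x => d; have [e ->] : exists e, d = e - 1 by exists (d + 1); lia.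
by move=> v; exists (@Homog K sV e v).
Qed.

Lemma map_dn_surj xs : exists ys, map dn ys = xs.
Proof.
elim: xs => [|x xs [ys <-]]; first by exists [::].
by have [y <-] := dn_surj x; exists (y :: ys).
Qed.

Lemma sdeg_cons (W : gspace K) x (xs : seq (homog W)) :
  sdeg (x :: xs) = hdeg x + sdeg xs.
Proof. by rewrite /sdeg big_cons. Qed.

Lemma sdeg_nil (W : gspace K) : sdeg ([::] : seq (homog W)) = 0.
Proof. by rewrite /sdeg big_nil. Qed.

Lemma sdeg1 (W : gspace K) (x : homog W) : sdeg [:: x] = hdeg x.
Proof. by rewrite sdeg_cons sdeg_nil addr0. Qed.

Lemma sdeg_dn ys : sdeg (map dn ys) = sdeg ys - (size ys)%:Z.
Proof.
elim: ys => [|y ys IH] /=; first by rewrite !sdeg_nil.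
rewrite !sdeg_cons IH hdeg_dn /=; lia.
Qed.

Lemma sum_nseq1 n : \sum_(d <- nseq n (1 : int)) d = n%:Z.
Proof. by elim: n => [|n IH] /=; rewrite ?big_nil // big_cons IH; lia. Qed.

(** The exponent of the sign of [s^{(x)n}] on the elements [s^-1 y_i]. *)
Definition susp_exp (ys : seq (homog sV)) : int :=
  kexp (nseq (size ys) 1) (map (@hdeg K V) (map dn ys)).

Local Notation kap := susp_exp.

Lemma kap_cons y ys : kap (y :: ys) = (size ys)%:Z * (hdeg y - 1) + kap ys.
Proof. by rewrite /kap /= sum_nseq1. Qed.

(** The last term counts the [size zs] suspensions of the second block passing the elements [s^-1 y]
    of the first, of total degree [sdeg ys - size ys]. *)
Lemma kap_cat ys zs :
  kap (ys ++ zs) = kap ys + kap zs + (sdeg ys - (size ys)%:Z) * (size zs)%:Z.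
Proof.
elim: ys => [|y ys IH] /=; first by rewrite sdeg_nil /kap /=; ring.
rewrite !kap_cons IH sdeg_cons size_cat /=; set a := size ys; set b := size zs.
rewrite PoszD intS; ring.
Qed.

(** [P = (-1)^e s^-1 Q s^{(x)n}], tested on the elements [s^-1 y]: this form
    avoids an explicit inverse of [desusp_elem], which would need a cast. *)
Record desuspends (e : int) (P : op V V) (Q : op sV sV) : Prop := Desuspends {
  desus_ar : oar P = oar Q;
  desus_dg : odg P = odg Q + (oar Q)%:Z - 1;
  desus_val : forall ys b,
    P (map dn ys) (b - 1) = (-1) ^ (e + kap ys) *: Q ys b }.

Inductive desuspends_list : int -> seq (op V V) -> seq (op sV sV) -> Prop :=
| Desus_nil : desuspends_list 0 [::] [::]
| Desus_cons e E P Q Ps Qs : desuspends e P Q -> desuspends_list E Ps Qs ->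
    desuspends_list (e + E) (P :: Ps) (Q :: Qs).

Lemma desus_cat E1 E2 Ps1 Ps2 Qs1 Qs2 :
  desuspends_list E1 Ps1 Qs1 -> desuspends_list E2 Ps2 Qs2 ->
  desuspends_list (E1 + E2) (Ps1 ++ Ps2) (Qs1 ++ Qs2).
Proof.
elim=> [|e E P Q Ps Qs dPQ _ IH] d2; first by rewrite add0r.
by rewrite -addrA; constructor=> //; exact: IH.
Qed.

Lemma desus_nseq n P Q : desuspends 0 P Q ->
  desuspends_list 0 (nseq n P) (nseq n Q).
Proof.
move=> dPQ; elim: n => [|n IH]; first by constructor.
by rewrite -[0]addr0; constructor.
Qed.

Lemma desus_map (T : eqType) (f : T -> op V V) (g : T -> op sV sV) s :
  {in s, forall x, desuspends 0 (f x) (g x)} ->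
  desuspends_list 0 (map f s) (map g s).
Proof.
elim: s => [|x s IH] fg; first by constructor.
rewrite -[0]addr0; constructor; first by apply: fg; rewrite mem_head.
by apply: IH => y ys; apply: fg; rewrite inE ys orbT.
Qed.

Lemma desus_idop : desuspends 0 (idop V) (idop sV).
Proof.
split=> // -[|y [|z ys]] b; rewrite /= ?scaler0 // kap_cons /= mul0r.
rewrite /kap /= addr0 scale1r.
have [<-|ne] := eqVneq (hdeg y) b; last by rewrite !hcomp_neq // hdeg_dn; lia.
by case: y => d v; rewrite -[existT _ d v]/(Homog v) hcompE /dn /= hcompE.
Qed.

(** Raw operations carry no linearity; this is the part of it that pulls signs out of the
    arguments. *)
Definition scalable_op (W U : gspace K) (f : op W U) :=
  forall xs ys d (a : K) (u : W d) b,
    f (xs ++ Homog (a *: u) :: ys) b = a *: f (xs ++ Homog u :: ys) b.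

Lemma gmap_linear0 (W U : gspace K) n d (f : gmap W U n d) xs ys e b :
  gval f (xs ++ Homog (0 : W e) :: ys) b = 0.
Proof.
have := gval_linear f xs ys 1 (0 : W e) 0 b.
by rewrite scaler0 addr0 scale1r => /eqP; rewrite -subr_eq subrr eq_sym => /eqP.
Qed.

Lemma gmap_scalable (W U : gspace K) n d (f : gmap W U n d) : scalable_op f.
Proof.
move=> xs ys e a u b; rewrite -[a *: u]addr0 /= gval_linear gmap_linear0 addr0.
by [].
Qed.

Definition hscale (W : gspace K) (p : int * homog W) : homog W :=
  Homog ((-1) ^ p.1 *: tagged p.2).

Lemma scalable_signs (W U : gspace K) (f : op W U) (ss : seq int) zs xs b :
  scalable_op f -> size ss = size zs ->
  f (xs ++ map (@hscale W) (zip ss zs)) b =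
    (-1) ^ (\sum_(s <- ss) s) *: f (xs ++ zs) b.
Proof.
move=> fZ; elim: ss zs xs => [|s ss IH] [|z zs] xs //=.
  by rewrite big_nil scale1r.
case=> sz; rewrite fZ big_cons signzD -scalerA; congr (_ *: _).
rewrite -cat_rcons IH // cat_rcons; congr (_ *: f _ b).
by case: z.
Qed.

Lemma kap_hscale ss zs : size ss = size zs ->
  kap (map (@hscale sV) (zip ss zs)) = kap zs.
Proof.
elim: zs ss => [|z zs IH] [|s ss] //= [sz].
by rewrite !kap_cons IH // size_map size_zip sz minnn.
Qed.

(** Names the argument list built inside [gcomp], as [koszul_exp] names its sign exponent, so that
    both can be treated by induction on [gs]. *)
Definition outputs (U W : gspace K) (gs : seq (op U W))
    (xs : seq (homog U)) : seq (homog W) :=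
  [seq Homog (oval p.1 p.2 (sdeg p.2 + odg p.1))
     | p <- zip gs (reshape (map (@oar K U W) gs) xs)].

Lemma outputs_cons (U W : gspace K) (g : op U W) gs xs ys : size xs = oar g ->
  outputs (g :: gs) (xs ++ ys) = Homog (g xs (sdeg xs + odg g)) :: outputs gs ys.
Proof.
by move=> sz; rewrite /outputs /= -sz take_size_cat // drop_size_cat.
Qed.

Lemma size_outputs (U W : gspace K) (gs : seq (op U W)) xs :
  size (outputs gs xs) = size gs.
Proof.
by rewrite size_map size_zip size_reshape size_map minnn.
Qed.

Definition koszul_exp (U W : gspace K) (gs : seq (op U W)) (xs : seq (homog U)) :=
  kexp (map (@odg K U W) gs)
    (map (@sdeg K U) (reshape (map (@oar K U W) gs) xs)).

Lemma koszul_exp_cons (U W : gspace K) (g : op U W) gs xs ys :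
  size xs = oar g ->
  koszul_exp (g :: gs) (xs ++ ys) =
    (\sum_(h <- gs) odg h) * sdeg xs + koszul_exp gs ys.
Proof.
move=> sz; rewrite /koszul_exp /= -sz take_size_cat // drop_size_cat //.
by rewrite big_map.
Qed.

Lemma desus_list_size E Ps Qs : desuspends_list E Ps Qs -> size Ps = size Qs.
Proof. by elim=> //= *; congr _.+1. Qed.

Lemma desus_list_ar E Ps Qs : desuspends_list E Ps Qs ->
  map (@oar K V V) Ps = map (@oar K sV sV) Qs.
Proof. by elim=> //= e {}E P Q {}Ps {}Qs [-> _ _] _ ->. Qed.

Lemma desus_list_dg E Ps Qs : desuspends_list E Ps Qs ->
  \sum_(P <- Ps) odg P =
    \sum_(Q <- Qs) odg Q + (sumn (map (@oar K sV sV) Qs))%:Z - (size Qs)%:Z.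
Proof.
elim=> [|e {}E P Q {}Ps {}Qs [_ dg _] _ IH] /=; first by rewrite !big_nil.
rewrite !big_cons IH dg PoszD intS; ring.
Qed.

(** The first summand comes from moving [s^{(x)k}] through [P_1 (x) ... (x) P_k], the second from
    moving each [Q_j] past the suspensions of the earlier blocks of inputs. *)
Definition list_exp (Ps : seq (op V V)) (Qs : seq (op sV sV)) : int :=
  kexp (nseq (size Ps) 1) (map (@odg K V V) Ps) +
  kexp (map (@odg K sV sV) Qs) (map (fun Q => (oar Q)%:Z) Qs).

(** The signs of [s^{(x)k} o (P_1 (x) ... (x) P_k)] and of
    [(Q_1 (x) ... (x) Q_k) o s^{(x)n}] combine, modulo 2, to the constant
    [list_exp], although each Koszul sign depends on the arguments. *)
Lemma desus_outputs E Ps Qs ys : desuspends_list E Ps Qs ->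
  size ys = sumn (map (@oar K sV sV) Qs) ->
  exists ss, [/\ size ss = size Qs,
    outputs Ps (map dn ys) = map dn (map (@hscale sV) (zip ss (outputs Qs ys)))
  & exists c : int,
    koszul_exp Ps (map dn ys) + \sum_(s <- ss) s + kap (outputs Qs ys) =
    E + list_exp Ps Qs + koszul_exp Qs ys + kap ys + 2 * c].
Proof.
move=> dE; elim: dE ys => {E Ps Qs} [|e E P Q Ps Qs dPQ dE IH] ys sz.
  case: ys sz => // _; exists [::]; split=> //; exists 0.
  by rewrite big_nil.
have [ar dg val] := dPQ.
have [Y [ys' [eqY sY]]] : exists Y ys', ys = Y ++ ys' /\ size Y = oar Q.
  exists (take (oar Q) ys), (drop (oar Q) ys); rewrite cat_take_drop size_takel
    //.
  by rewrite sz /= leq_addr.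
rewrite {ys}eqY in sz *; rewrite size_cat /= in sz.
have {}sz : size ys' = sumn (map (@oar K sV sV) Qs) by lia.
have [ss [sss Hout [c Hc]]] := IH _ sz.
exists (e + kap Y :: ss); split; first by rewrite /= sss.
  rewrite map_cat !outputs_cons // ?size_map ?ar //.
  rewrite Hout /=; congr (_ :: _).
  have -> : sdeg (map dn Y) + odg P = sdeg Y + odg Q - 1.
    by rewrite sdeg_dn dg sY; ring.
  by rewrite val.
(* After expansion the only discrepancy is the degree of the remaining [Qs] times the arity of [Q]:
   it occurs with coefficient -1 on the left, from the Koszul sign, and +1 on the right, from
   [list_exp]. *)
exists (c - (\sum_(q <- Qs) odg q) * (oar Q)%:Z).
rewrite map_cat !outputs_cons // !koszul_exp_cons // ?size_map ?ar //.
rewrite kap_cons /= kap_cat size_outputs big_cons /list_exp /=.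
rewrite !big_map sum_nseq1 sdeg_dn sY (desus_list_size dE) (desus_list_dg dE).
rewrite dg sz.
move: Hc; rewrite /list_exp (desus_list_size dE).
set o := kexp (nseq _ _) _; set o' := kexp _ (map _ Qs).
move: (koszul_exp Ps _) (\sum_(s <- ss) s) (kap (outputs _ _)) (koszul_exp Qs _)
  (kap ys') => a1 a2 a3 a4 a5 H.
move: (\sum_(q <- Qs) odg q) (sumn _) (size Qs) (oar Q) (odg Q) (sdeg Y) (kap Y)
  => q n k m q1 y kY.
have -> : a1 = E + (o + o') + a4 + a5 + 2 * c - a2 - a3 by rewrite -H; ring.
ring.
Qed.

(** In [s^-1 Q s^{(x)k} (P_1 (x) ... (x) P_k)] the suspensions are distributed over the [P_i], each
    [s P_i] becomes [Q_i s^{(x)n_i}], and the suspensions are collected again on the right. All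
    signs of the theorem are instances of the resulting exponent. *)
Lemma desus_gcomp e E P Q Ps Qs :
  scalable_op Q -> desuspends e P Q -> oar Q = size Qs ->
  desuspends_list E Ps Qs ->
  desuspends (e + E + list_exp Ps Qs) (gcomp P Ps) (gcomp Q Qs).
Proof.
move=> QZ [ar dg val] sQ dE; split=> [||ys b] /=.
- by rewrite (desus_list_ar dE).
- by rewrite (desus_list_dg dE) dg sQ; ring.
rewrite (desus_list_ar dE) size_map; case: eqP => [sz|_]; last by rewrite scaler0.
have [ss [sss Hout [c Hc]]] := desus_outputs dE sz.
rewrite -(desus_list_ar dE) -/(koszul_exp Ps _) -/(outputs Ps _).
rewrite -/(koszul_exp Qs ys) -/(outputs Qs _) Hout val.
have /= -> := @scalable_signs _ _ _ _ _ [::] _ QZ _;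
  last by rewrite sss size_outputs.
rewrite !scalerA -!signzD (desus_list_ar dE) -/(koszul_exp Qs ys) -/(outputs Qs _).
congr (_ *: _); apply: (@signz_even _ _ c).
rewrite kap_hscale ?sss ?size_outputs //; move: Hc.
move: (koszul_exp Ps _) (koszul_exp Qs _) (kap ys) (kap _) (list_exp _ _).
by move: (\sum_(s <- ss) s) => *; lia.
Qed.


Lemma reshape_nseq1 (T : Type) (xs : seq T) :
  reshape (nseq (size xs) 1%N) xs = [seq [:: x] | x <- xs].
Proof. by elim: xs => //= x xs IH; rewrite take0 drop0 IH. Qed.

Lemma kexp_nseq0 n es : kexp (nseq n 0) es = 0.
Proof.
elim: n es => [|n IH] [|e es] //=; rewrite IH addr0 big_nseq.
by elim: n {IH} => [|n IH] /=; rewrite ?mul0r // add0r.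
Qed.

(** [gcomp] returns 0 on wrong arities and [desusp] in wrong degrees, so a raw operation can be
    compared with its composites with identities or suspensions only if it vanishes there too. *)
Definition supported_op (U W : gspace K) (f : op U W) := forall xs b,
  (size xs != oar f) || (b != sdeg xs + odg f) -> f xs b = 0.

Lemma gmap_supported (U W : gspace K) n d (f : gmap U W n d) : supported_op f.
Proof. exact: gval_supp. Qed.

Lemma gcomp_idop (U W : gspace K) (f : op U W) xs b : supported_op f ->
  gcomp f (nseq (oar f) (idop U)) xs b = f xs b.
Proof.
move=> fS; rewrite /= !map_nseq sumn_nseq mul1n; case: eqP => sz; last first.
  by rewrite fS //; apply/orP; left; apply/eqP.
rewrite kexp_nseq0 scale1r -sz reshape_nseq1; congr (f _ b).
elim: xs {sz} => //= x xs ->; rewrite sdeg1 addr0 Homog_hcomp //.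
Qed.

(** [treecomp] composes a topmost vertex with the identities on its leaves, so such vertices carry
    this composite instead of [Q] itself. *)
Lemma desus_corolla e P Q : desuspends e P Q -> supported_op Q ->
  desuspends e P (gcomp Q (nseq (oar Q) (idop sV))).
Proof.
move=> [ar dg val] QS.
have arE : oar (gcomp Q (nseq (oar Q) (idop sV))) = oar Q.
  by rewrite /= map_nseq sumn_nseq mul1n.
have dgE : odg (gcomp Q (nseq (oar Q) (idop sV))) = odg Q.
  rewrite /= big_nseq; elim: (oar Q) => [|n IH] /=; first by rewrite addr0.
  by rewrite add0r.
by split=> [||ys b]; rewrite ?arE ?dgE // gcomp_idop.
Qed.

Lemma desuspE (f : op sV sV) ys b : supported_op f ->
  desusp f (map dn ys) (b - 1) = (-1) ^ kap ys *: f ys b.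
Proof.
move=> fS; rewrite /desusp [gcomp _ (nseq _ _)]lock /= -lock /=.
rewrite !map_nseq sumn_nseq mul1n size_map; case: eqP => sz; last first.
  by rewrite fS ?scaler0 //; apply/orP; left; apply/eqP.
have -> : [seq Homog (oval p.1 p.2 (sdeg p.2 + odg p.1))
   | p <- zip (nseq (oar f) (sop V)) (reshape (nseq (oar f) 1%N) (map dn ys))] = ys.
  rewrite -sz -(size_map dn) reshape_nseq1.
  elim: ys {sz} => //= -[d v] ys -> /=; congr (_ :: _).
  rewrite sdeg1 /dn /hdeg /=.
  have -> : d - 1 + 1 = d by ring.
  by rewrite hcompE.
rewrite addn0 sz eqxx /= big_nil mul0r add0r scale1r.
rewrite take_oversize ?sz //; congr (_ *: _).
  rewrite /kap -sz -(size_map dn) reshape_nseq1 -map_comp.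
  by congr (_ ^ kexp _ _); apply: eq_map => x; rewrite /= sdeg1.
(* [sinvop] sees only the component of [f] in degree [sdeg ys + odg f]; in any other degree both
   sides vanish, the right one by [fS]. *)
have [<-|ne] := eqVneq (sdeg ys + odg f) b; first by rewrite hcompE.
rewrite hcomp_neq; last by rewrite /hdeg /=; lia.
by rewrite fS // (eq_sym b) ne orbT.
Qed.


(** The uniqueness claims concern Leibniz equality of records that contain proofs; proof irrelevance
    enters here. *)
Lemma gmap_ext (U W : gspace K) n d (f g : gmap U W n d) :
  (forall xs b, gval f xs b = gval g xs b) -> f = g.
Proof.
case: f g => [f f1 f2] [g g1 g2] /= fg.
have {}fg : f = g.
  by apply: functional_extensionality => xs; apply: functional_extensionality_dep.
rewrite fg in f1 f2 *.
by rewrite (proof_irrelevance _ f1 g1) (proof_irrelevance _ f2 g2).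
Qed.

Lemma int_shift (b : int) : exists c, b = c - 1.
Proof. by exists (b + 1); ring. Qed.

(** * Bijection between linear maps on [V] and on [sV] *)

Section DesuspGmap.

Variables (n : nat) (d d' : int).

Lemma desusp_supp (f : gmap sV sV n d) (dE : d' = d + n%:Z - 1) xs b :
  (size xs != n) || (b != sdeg xs + d') -> desusp f xs b = 0.
Proof.
have [ys <-] := map_dn_surj xs; have [c ->] := int_shift b.
have fS := @gmap_supported _ _ _ _ f; rewrite size_map sdeg_dn dE => supp.
rewrite desuspE //.
have [sz|/negbTE sz] := eqVneq (size ys) n; last by rewrite fS ?scaler0 //= sz.
rewrite fS ?scaler0 //=; move: supp; rewrite sz !eqxx /=.
by move=> ne; apply/eqP => eqc; case/eqP: ne; rewrite eqc; ring.
Qed.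

Lemma desusp_linear (f : gmap sV sV n d) xs ys e (a : K) (u v : V e) b :
  desusp f (xs ++ Homog (a *: u + v) :: ys) b =
    a *: desusp f (xs ++ Homog u :: ys) b + desusp f (xs ++ Homog v :: ys) b.
Proof.
have [xs' <-] := map_dn_surj xs; have [ys' <-] := map_dn_surj ys.
(* With [e] in the form [e' - 1], the vectors [u] and [v] live in [sV] in degree [e'] by conversion;
   [kap] sees only this degree, so the three signs agree. *)
have [c ->] := int_shift b; have [e' ee'] := int_shift e.
rewrite {e}ee' in u v *.
have mapE (w : V (e' - 1)) :
    map dn xs' ++ Homog w :: map dn ys' = map dn (xs' ++ @Homog K sV e' w :: ys').
  by rewrite map_cat.
rewrite !mapE !desuspE; try exact: gval_supp.
rewrite -[LHS]/(_ *: gval f _ _) gval_linear scalerDr !scalerA [a * _]mulrC.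
congr ((_ * _) *: _ + _ *: _); rewrite /kap !size_cat /= !map_cat //.
Qed.

Definition desusp_gmap (f : gmap sV sV n d) (dE : d' = d + n%:Z - 1) :
  gmap V V n d' := GMap (desusp_supp f dE) (@desusp_linear f).

(** The formula of [desuspE] solved for [f]: the sign is its own inverse. *)
Definition susp_val (g : gmap V V n d') ys b : sV b :=
  (-1) ^ kap ys *: gval g (map dn ys) (b - 1).

Lemma susp_supp (g : gmap V V n d') (dE : d' = d + n%:Z - 1) ys b :
  (size ys != n) || (b != sdeg ys + d) -> susp_val g ys b = 0.
Proof.
move=> supp; rewrite /susp_val.
rewrite [X in _ *: X](_ : _ = 0) ?scaler0 // gval_supp //.
have [sz|/negbTE sz] := eqVneq (size ys) n; last by rewrite size_map sz.
move: supp; rewrite size_map sdeg_dn dE sz !eqxx /=.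
by move=> ne; apply/eqP => eqc; case/eqP: ne; rewrite -[b](subrK 1) eqc; ring.
Qed.

Lemma susp_linear (g : gmap V V n d') xs ys e (a : K) (u v : sV e) b :
  susp_val g (xs ++ Homog (a *: u + v) :: ys) b =
    a *: susp_val g (xs ++ Homog u :: ys) b + susp_val g (xs ++ Homog v :: ys) b.
Proof.
rewrite /susp_val !map_cat /= {1}/dn /=.
rewrite [gval g _ _](gval_linear g (map dn xs) (map dn ys) a (u : V (e - 1)) v).
rewrite scalerDr !scalerA [a * _]mulrC.
by congr ((_ * _) *: _ + _ *: _); rewrite /kap !size_cat /= !map_cat.
Qed.

Definition susp_gmap (g : gmap V V n d') (dE : d' = d + n%:Z - 1) :
  gmap sV sV n d := GMap (susp_supp g dE) (@susp_linear g).

Lemma susp_gmapK (g : gmap V V n d') dE xs b :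
  gval g xs b = desusp (susp_gmap g dE) xs b.
Proof.
have [ys <-] := map_dn_surj xs; have [c ->] := int_shift b.
rewrite desuspE /=; last exact: gval_supp.
rewrite /susp_val scalerA -signzD (@signz_even _ 0 (kap ys)) ?scale1r //; ring.
Qed.

Lemma desusp_inj (f g : gmap sV sV n d) :
  (forall xs b, desusp f xs b = desusp g xs b) -> f = g.
Proof.
move=> fg; apply: gmap_ext => ys b.
have := fg (map dn ys) (b - 1); rewrite !desuspE; try exact: gval_supp.
exact/scalerI/signz_neq0.
Qed.

End DesuspGmap.

(** On each constructor this reduces to the degree written in [hrbs_data], which is only
    propositionally the degree of the desuspension; passing the equation to [desusp_gmap] avoids a
    cast. *)
Definition gen_arity_degree (c : gen) (n : nat) : int :=
  if c is gu then n.+1%:Z - 2 else n.+1%:Z - 1.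

Lemma gen_arity_degreeE c n :
  gen_arity_degree c n = (gdeg c - 1 + 0) + n.+1%:Z - 1.
Proof. by case: c; rewrite /gen_arity_degree /=; ring. Qed.

Lemma desusp_unique (phi : welem V 0) : exists! F : hrbs_data V, corresponds phi F.
Proof.
have dE c n := gen_arity_degreeE c n.
exists (HRBSData (fun n => desusp_gmap (phi n gu) (dE gu n))
                 (fun n => desusp_gmap (phi n gv) (dE gv n))
                 (fun n => desusp_gmap (phi n gw) (dE gw n))); split=> // F' cF.
case: F' cF => hm hR hS cF; congr HRBSData;
  apply: functional_extensionality_dep => n; apply: gmap_ext => xs b;
  by case: (cF n xs b).
Qed.

Lemma susp_unique (F : hrbs_data V) : exists! phi : welem V 0, corresponds phi F.
Proof.
have dE c n := gen_arity_degreeE c n.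
exists (fun n c => match c return gmap sV sV n.+1 (gdeg c - 1 + 0) with
  | gu => susp_gmap (hm F n) (dE gu n) | gv => susp_gmap (hR F n) (dE gv n)
  | gw => susp_gmap (hS F n) (dE gw n) end); split=> [n xs b|phi cphi].
  by split; exact: susp_gmapK.
apply: functional_extensionality_dep => n; apply: functional_extensionality_dep.
by case; apply: desusp_inj => xs b; rewrite -susp_gmapK; case: (cphi n xs b).
Qed.

Definition hrbs_op (F : hrbs_data V) (c : gen) : nat -> op V V :=
  match c with gu => mop F | gv => Rop F | gw => Sop F end.

Lemma desus_hrbs (phi : welem V 0) F (c : gen) n : corresponds phi F ->
  desuspends 0 (hrbs_op F c n) (wop (existT _ 0 phi : whomog V) n c).
Proof.
move=> cF; split=> [||ys b]; first by case: c.
  by case: c; rewrite /=; ring.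
rewrite add0r -desuspE; last exact: gval_supp.
by case: (cF n.-1 (map dn ys) (b - 1)); case: c.
Qed.

End Desuspension.

#[local] Arguments weight : simpl never.
#[local] Arguments treecomp : simpl never.

(** A name for the anonymous inner fixpoint of [treecomp], which makes [treecomp_Node] hold by
    conversion. *)
Definition branches (K : fieldType) (W : gspace K) :
    seq tree -> seq (op W W) -> seq (op W W) :=
  fix branches ts fs :=
    if ts is t :: ts' then
      treecomp t (take (weight t) fs) :: branches ts' (drop (weight t) fs)
    else [::].

(** * Composition along the trees of types I, II and III *)

Section TreeComposition.

Variables (K : fieldType) (W : gspace K).
Implicit Types (f g : op W W) (fs : seq (op W W)).

Lemma treecomp_Node ts f fs :
  treecomp (Node ts) (f :: fs) = gcomp f (branches ts fs).
Proof. by []. Qed.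

Lemma branches_cons t ts fs : branches (t :: ts) fs =
  treecomp t (take (weight t) fs) :: branches ts (drop (weight t) fs).
Proof. by []. Qed.

Lemma branches_cat ts1 ts2 fs1 fs2 : size fs1 = sumn (map weight ts1) ->
  branches (ts1 ++ ts2) (fs1 ++ fs2) = branches ts1 fs1 ++ branches ts2 fs2.
Proof.
elim: ts1 fs1 => [|t ts1 IH] fs1 /=; first by move/size0nil ->.
move=> sz; rewrite take_cat drop_cat.
case: ltnP => [lt|le]; first by rewrite -IH // size_drop sz; lia.
(* Here [t] uses up [fs1], so the remaining trees of [ts1] have total weight 0. *)
have sw : size fs1 = weight t by lia.
rewrite sw subnn take0 drop0 cats0 take_oversize ?sw //.
by rewrite -[fs2]cat0s IH ?drop_oversize ?sw //=; lia.
Qed.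

Lemma branches_Leaf n fs : branches (nseq n Leaf) fs = nseq n (idop W).
Proof. by elim: n fs => //= n IH fs; rewrite IH. Qed.

Lemma weight_corolla j : weight (corolla j) = 1%N.
Proof. by rewrite weight_Node map_nseq sumn_nseq. Qed.

Lemma treecomp_corolla j f : treecomp (corolla j) [:: f] = gcomp f (nseq j (idop W)).
Proof. by rewrite treecomp_Node branches_Leaf. Qed.

Lemma branches_corolla (F : nat -> op W W) r :
  branches (map corolla r) (map F r) = [seq gcomp (F l) (nseq l (idop W)) | l <- r].
Proof.
elim: r => // l r IH; rewrite !map_cons branches_cons weight_corolla.
by rewrite [drop _ _]drop0 [take _ _]/= take0 IH treecomp_corolla.
Qed.

Lemma sumn_weight_corolla r : sumn (map weight (map corolla r)) = size r.
Proof. by elim: r => // l r IH; rewrite !map_cons weight_corolla /= IH. Qed.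

Lemma sumn_weight_Leaf n : sumn (map weight (nseq n Leaf)) = 0%N.
Proof. by rewrite map_nseq sumn_nseq. Qed.

(** Types I and III share this shape: one tree grafted on a root whose other inputs are leaves. *)
Lemma treecomp_insert f fs t i k :
  size fs = weight t ->
  treecomp (Node (nseq i Leaf ++ t :: nseq k Leaf)) (f :: fs) =
  gcomp f (nseq i (idop W) ++ treecomp t fs :: nseq k (idop W)).
Proof.
move=> sz; rewrite treecomp_Node -[fs]cat0s branches_cat ?sumn_weight_Leaf //=.
by rewrite !branches_Leaf take_oversize ?sz.
Qed.

Lemma treecomp_treeI n j i f g :
  treecomp (treeI n j i) [:: f; g] =
  gcomp f (nseq i.-1 (idop W) ++
           gcomp g (nseq j (idop W)) :: nseq (n - j + 1 - i) (idop W)).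
Proof. by rewrite treecomp_insert ?weight_corolla // treecomp_corolla. Qed.

Lemma treecomp_treeII (F : nat -> op W W) r f :
  treecomp (treeII r) (f :: map F r) =
  gcomp f [seq gcomp (F l) (nseq l (idop W)) | l <- r].
Proof. by rewrite treecomp_Node branches_corolla. Qed.

Lemma treecomp_treeIII (F G : nat -> op W W) r j i f g :
  let rs := behead r in
  treecomp (treeIII r j i)
    [:: f, g & map F (take j.-1 rs) ++ map G (drop j.-1 rs)] =
  gcomp f (nseq i.-1 (idop W) ++
    gcomp g ([seq gcomp (F l) (nseq l (idop W)) | l <- take j.-1 rs] ++
             idop W :: [seq gcomp (G l) (nseq l (idop W)) | l <- drop j.-1 rs])
    :: nseq (part r 1 - i) (idop W)).
Proof.
rewrite /= treecomp_insert; last first.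
  rewrite weight_Node map_cat sumn_cat /= !sumn_weight_corolla size_cat !size_map.
  by [].
rewrite treecomp_Node branches_cat ?size_map ?sumn_weight_corolla //=.
by rewrite drop0 !branches_corolla.
Qed.

End TreeComposition.

Lemma weight_insert t i k :
  weight (Node (nseq i Leaf ++ t :: nseq k Leaf)) = (weight t).+1.
Proof.
by rewrite weight_Node map_cat sumn_cat /= !sumn_weight_Leaf addn0.
Qed.

Lemma leaves_corolla j : leaves (corolla j) = j.
Proof. by rewrite /= map_nseq sumn_nseq mul1n. Qed.

Lemma wf_corolla j : (0 < j)%N -> wf_tree (corolla j).
Proof. by case: j => //= j _; rewrite all_nseq orbT. Qed.

Lemma leaves_insert t i k :
  leaves (Node (nseq i Leaf ++ t :: nseq k Leaf)) = (i + leaves t + k)%N.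
Proof. by rewrite /= map_cat sumn_cat /= !map_nseq !sumn_nseq !mul1n addnA. Qed.

Lemma wf_insert t i k :
  wf_tree (Node (nseq i Leaf ++ t :: nseq k Leaf)) = wf_tree t.
Proof.
rewrite /= all_cat /= !all_nseq !orbT /= andbT.
by case: i.
Qed.

Lemma arities_insert t i k :
  arities (Node (nseq i Leaf ++ t :: nseq k Leaf)) = (i + 1 + k)%N :: arities t.
Proof.
rewrite /= map_cat flatten_cat /= !map_nseq size_cat /= !size_nseq.
have fl m : flatten (nseq m ([::] : seq nat)) = [::] by elim: m.
by rewrite !fl cats0 addn1 addSnnS.
Qed.

Lemma arities_corollas r : flatten (map arities (map corolla r)) = r.
Proof.
elim: r => //= l r ->; rewrite map_nseq size_nseq /=.
by have -> : flatten (nseq l ([::] : seq nat)) = [::] by elim: l.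
Qed.

Lemma arities_corolla j : arities (corolla j) = [:: j].
Proof. by rewrite -[LHS]cats0; exact: (arities_corollas [:: j]). Qed.

Lemma leaves_corollas r : sumn (map leaves (map corolla r)) = sumn r.
Proof. by elim: r => //= l r ->; rewrite map_nseq sumn_nseq mul1n. Qed.

Lemma wf_corollas r : all (leq 1) r -> all wf_tree (map corolla r).
Proof.
by elim: r => // l r IH /andP[l1 /IH rwf]; apply/andP; rewrite wf_corolla.
Qed.

(** The first three properties place the tree in the enumeration [trees]; the arities tell which
    component sits at each vertex. *)
Lemma treeI_spec n j i : (1 <= j <= n)%N -> (1 <= i <= n - j + 1)%N ->
  [/\ wf_tree (treeI n j i), weight (treeI n j i) = 2%N, leaves (treeI n j i) = n
    & arities (treeI n j i) = [:: (n - j + 1)%N; j]].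
Proof.
move=> /andP[j1 jn] /andP[i1 i2]; rewrite /treeI.
rewrite wf_insert weight_insert leaves_insert arities_insert.
rewrite wf_corolla // weight_corolla leaves_corolla arities_corolla.
by split=> //; [lia | congr [:: _; _]; lia].
Qed.

Lemma treeII_spec k n (r : seq nat) : (1 <= k)%N -> r \in compositions k n ->
  [/\ wf_tree (treeII r), weight (treeII r) = k.+1, leaves (treeII r) = n
    & arities (treeII r) = k :: r].
Proof.
rewrite mem_compositions => k1 /and3P[/eqP sr r1 /eqP nr]; rewrite /treeII.
rewrite weight_Node /= wf_corollas // leaves_corollas arities_corollas size_map.
rewrite sumn_weight_corolla sr nr; split=> //; rewrite andbT.
by case: r sr k1 {r1 nr} => // <-.
Qed.

Lemma treeIII_spec p n (r : seq nat) j i : (1 <= p)%N -> r \in compositions p n ->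
  (1 <= j <= p)%N -> (1 <= i <= part r 1)%N ->
  [/\ wf_tree (treeIII r j i), weight (treeIII r j i) = p.+1,
      leaves (treeIII r j i) = n
    & arities (treeIII r j i) = [:: part r 1, p & behead r]].
Proof.
rewrite mem_compositions => p1 /and3P[/eqP sr r1 /eqP nr].
case: r sr r1 nr => [|a rs]; first by move=> p0; rewrite -p0 in p1.
rewrite -[part _ 1]/a => sr /andP[a1 r1] nr /andP[j1 jp] /andP[i1 ia].
rewrite /treeIII -[part _ 1]/a -[behead _]/rs.
rewrite wf_insert weight_insert leaves_insert arities_insert.
have szd : (size (take j.-1 rs) + size (drop j.-1 rs))%N = size rs.
  by rewrite -size_cat cat_take_drop.
rewrite weight_Node /= !map_cat !sumn_cat /= !sumn_weight_corolla !leaves_corollas.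
rewrite all_cat /= size_cat /= !size_map flatten_cat /= !arities_corollas.
have /andP[r1t r1d] : all (leq 1) (take j.-1 rs) && all (leq 1) (drop j.-1 rs).
  by rewrite -all_cat cat_take_drop.
rewrite !wf_corollas // cat_take_drop.
have := cat_take_drop j.-1 rs => /(congr1 sumn); rewrite sumn_cat => sm.
rewrite /= in sr nr.
rewrite -[weight Leaf]/0%N; split=> //; [| lia | lia | congr [:: _, _ & _]; lia].
by case: (take _ _).
Qed.

(** * Collapsing sums over trees to sums over the parameters of a type *)

Section TreeSums.

Variables (W : nmodType) (n N : nat).

Definition tree_sum (H : tree -> W) : W :=
  \sum_(1 <= m < N.+1) \sum_(T <- trees m n) H T.

Lemma tree_sum_sum (I : Type) (s : seq I) (H : I -> tree -> W) :
  tree_sum (fun T => \sum_(a <- s) H a T) = \sum_(a <- s) tree_sum (H a).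
Proof.
rewrite /tree_sum [RHS]exchange_big; apply: eq_bigr => m _.
by rewrite [RHS]exchange_big.
Qed.

Lemma tree_sumD (H1 H2 : tree -> W) :
  tree_sum (fun T => H1 T + H2 T) = tree_sum H1 + tree_sum H2.
Proof.
by rewrite /tree_sum -big_split; apply: eq_bigr => m _; rewrite big_split.
Qed.

Lemma eq_tree_sum (H1 H2 : tree -> W) : H1 =1 H2 -> tree_sum H1 = tree_sum H2.
Proof.
by move=> eqH; apply: eq_bigr => m _; apply: eq_bigr => T _; exact: eqH.
Qed.

(** Once the sum over the parameters is outermost, each parameter value meets its own tree exactly
    once, in weight [weight T0]. *)
Lemma tree_sum_at (A : Type) (T0 : tree) (L : seq A) (F : tree -> A -> W) :
  wf_tree T0 -> leaves T0 = n -> (1 <= weight T0 <= N)%N ->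
  tree_sum (fun T => \sum_(t <- if T == T0 then L else [::]) F T t) =
  \sum_(t <- L) F T0 t.
Proof.
move=> wf lT wT; rewrite /tree_sum.
have inner m : \sum_(T <- trees m n) \sum_(t <- if T == T0 then L else [::]) F T t
    = if weight T0 == m then \sum_(t <- L) F T0 t else 0.
  case: ifP => wm.
    rewrite (bigD1_seq T0) ?uniq_trees ?mem_trees ?wf ?lT ?wm ?eqxx //=.
    by rewrite [X in _ + X]big1 ?addr0 // => T /negbTE ->; rewrite big_nil.
  rewrite big_seq big1 // => T; rewrite mem_trees => /and3P[_ /eqP wT' _].
  by case: eqP => [eT|_]; rewrite ?big_nil //; rewrite -wT' eT eqxx in wm.
rewrite (eq_bigr _ (fun m _ => inner m)) (bigD1_seq (weight T0)) ?iota_uniq //=.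
  rewrite eqxx [X in _ + X]big1 ?addr0 // => m.
  by rewrite eq_sym => /negbTE ->.
by rewrite mem_index_iota ltnS.
Qed.

End TreeSums.

Lemma big_pick (W : nmodType) (I : eqType) (s : seq I) a (F : I -> W) :
  uniq s -> a \in s -> \sum_(i <- s) (if i == a then F i else 0) = F a.
Proof.
move=> us sa; rewrite (bigD1_seq a) //= eqxx big1 ?addr0 // => i.
by move/negbTE ->.
Qed.

Lemma big_flatten_allpairs (W : nmodType) (I J A : Type) (s : seq I)
    (t : I -> seq J) (f : I -> J -> seq A) (G : A -> W) :
  \sum_(x <- flatten [seq f i j | i <- s, j <- t i]) G x =
  \sum_(i <- s) \sum_(j <- t i) \sum_(x <- f i j) G x.
Proof.
rewrite !big_flatten big_map; apply: eq_bigr => i _; exact: big_map.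
Qed.

(** The Koszul exponent of applying [s^{(x)k}] to factors of degrees [ds]; for [s^-1] it is the
    negative, hence the same sign. *)
Definition ksusp (ds : seq int) : int := kexp (nseq (size ds) 1) ds.

Lemma ksusp_cons d ds : ksusp (d :: ds) = (size ds)%:Z * d + ksusp ds.
Proof. by rewrite /ksusp /= sum_nseq1. Qed.

Lemma ksusp_nseq1 k : ksusp (nseq k 1) = ((k * (k - 1))./2)%:Z.
Proof.
rewrite subn1 -bin2; elim: k => // k IH.
by rewrite ksusp_cons IH size_nseq binS bin1; lia.
Qed.

(** * The Maurer-Cartan sum *)

Section MaurerCartan.

Variables (K : fieldType) (V : gspace K) (phi : welem V 0).

Local Notation Phi := (existT _ 0 phi : whomog V).

(** [Phi] has degree 0 and moves without sign, so only the sign of [(s^-1)^{(x)m}] remains. *)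
Lemma conv_termE (T : tree) cs ys b : size cs = weight T ->
  conv_term T (nseq (weight T) Phi) cs ys b =
    (-1) ^ ksusp (map gdeg cs) *:
      treecomp T [seq wop Phi q.1 q.2 | q <- zip (arities T) cs] ys b.
Proof.
move=> sz; rewrite /conv_term map_nseq kexp_nseq0 scale1r size_nseq.
have -> : kexp (nseq (weight T) (-1)) (map gdeg cs) = - ksusp (map gdeg cs).
  rewrite /ksusp size_map sz; elim: (weight T) (map gdeg cs) => [|w IH] [|d ds] //=.
  rewrite IH opprD -mulNr; congr (_ * _ + _).
  by elim: w {IH} => [|w IH]; rewrite ?big_nil //= !big_cons IH; ring.
congr (_ *: _); first by apply: (@signz_even _ _ _ (- ksusp (map gdeg cs))); ring.
congr (treecomp T _ ys b).
have : size (zip (arities T) cs) = weight T by rewrite size_zip sz minnn.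
by elim: (zip _ _) (weight T) => [|q l IH] [|w] //= [/IH ->].
Qed.

Definition Delta_val ys b (T : tree) (t : K * seq gen) : susp V b :=
  t.1 *: conv_term T (nseq (weight T) Phi) t.2 ys b.

Lemma lambda_diag m n c ys b : (m`!%:R : K) != 0 ->
  (m`!%:R)^-1 *: lambda (fun _ : 'I_m => Phi) n c ys b =
  - \sum_(T <- trees m n) \sum_(t <- Delta K n T c) Delta_val ys b T t.
Proof.
move=> m0; rewrite /lambda /= big1 // addr0 expr1z scaleN1r scalerN; congr (- _).
rewrite scaler_sumr big_seq [RHS]big_seq; apply: eq_bigr => T.
rewrite mem_trees => /and3P[_ /eqP wT _].
rewrite (eq_bigr (fun=> \sum_(t <- Delta K n T c) Delta_val ys b T t)); last first.
  move=> s _; rewrite /koszul big1 ?scale1r => [|i _]; last by rewrite big1.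
  apply: eq_bigr => t _; rewrite /Delta_val wT; congr (_ *: conv_term _ _ _ _ _).
  by rewrite -[in RHS](size_enum_ord m); elim: (enum _) => //= i l ->.
by rewrite sumr_const card_Sn -scaler_nat scalerA mulVf // scale1r.
Qed.

Lemma lambda_sum n c N ys b : [pchar K] =i pred0 ->
  \sum_(1 <= m < N.+1) (m`!%:R)^-1 *: lambda (fun _ : 'I_m => Phi) n c ys b =
  - tree_sum n N (fun T => \sum_(t <- Delta K n T c) Delta_val ys b T t).
Proof.
move=> /pcharf0P K0; rewrite /tree_sum -sumrN; apply: eq_bigr => m _.
by rewrite lambda_diag // K0 -lt0n fact_gt0.
Qed.


Section Delta.

Variables (n N : nat) (ys : seq (homog (susp V))) (b : int).
Hypotheses (n_gt0 : (0 < n)%N) (ltnN : (n < N)%N).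

Local Notation val := (Delta_val ys b).
Local Notation v := (wop Phi).

Lemma DeltaI_sum c :
  tree_sum n N (fun T => \sum_(t <- DeltaI K n T c) val T t) =
  \sum_(j <- iota 1 n) \sum_(i <- iota 1 (n - j + 1))
    \sum_(t <- if c is gu then [:: (1, [:: gu; gu])] else
                 (if j == 1%N then [:: (1, [:: c; gu])] else [::]) ++
                 (if j == n then [:: (1, [:: gu; c])] else [::]))
      val (treeI n j i) t.
Proof.
under eq_tree_sum do rewrite big_flatten_allpairs.
rewrite tree_sum_sum big_seq [RHS]big_seq; apply: eq_bigr => j.
rewrite mem_iota => jn; rewrite tree_sum_sum big_seq [RHS]big_seq.
apply: eq_bigr => i; rewrite mem_iota => ijn.
have [| | wf wT lT _] := @treeI_spec n j i; [lia | lia |].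
by rewrite tree_sum_at // wT; lia.
Qed.

Lemma DeltaII_sum c : c <> gu ->
  tree_sum n N (fun T => \sum_(t <- DeltaII K n T c) val T t) =
  \sum_(k <- iota 2 n.-1) \sum_(r <- compositions k n)
    val (treeII r) ((-1) ^+ (k * (k - 1))./2, gu :: nseq k c).
Proof.
move=> cNu.
have DE T : DeltaII K n T c = flatten [seq
    if T == treeII r then [:: ((-1) ^+ (k * (k - 1))./2, gu :: nseq k c)] else [::]
  | k <- iota 2 n.-1, r <- compositions k n] by case: c cNu.
under eq_tree_sum do rewrite DE big_flatten_allpairs.
rewrite tree_sum_sum big_seq [RHS]big_seq; apply: eq_bigr => k.
rewrite mem_iota => kn; rewrite tree_sum_sum big_seq [RHS]big_seq.
apply: eq_bigr => r rkn.
have [| wf wT lT _] := treeII_spec _ rkn; first by lia.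
by rewrite tree_sum_at ?big_seq1 // wT; lia.
Qed.

Lemma DeltaIII_sum c : c <> gu ->
  tree_sum n N (fun T => \sum_(t <- DeltaIII K n T c) val T t) =
  \sum_(p <- iota 2 n.-1) \sum_(r <- compositions p n)
    \sum_(j <- iota 1 p) \sum_(i <- iota 1 (part r 1))
    val (treeIII r j i) ((-1) ^+ (p * (p - 1))./2,
           [:: c, gu & nseq j.-1 gv ++ nseq (p - j) gw]).
Proof.
move=> cNu.
have DE T : DeltaIII K n T c = flatten (flatten [seq [seq
    if T == treeIII r j i then
      [:: ((-1) ^+ (p * (p - 1))./2,
           [:: c, gu & nseq j.-1 gv ++ nseq (p - j) gw])]
    else [::]
  | j <- iota 1 p, i <- iota 1 (part r 1)]
  | p <- iota 2 n.-1, r <- compositions p n]) by case: c cNu.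
under eq_tree_sum do rewrite DE big_flatten big_flatten_allpairs.
rewrite tree_sum_sum big_seq [RHS]big_seq; apply: eq_bigr => p.
rewrite mem_iota => pn; rewrite tree_sum_sum big_seq [RHS]big_seq.
apply: eq_bigr => r rpn.
under eq_tree_sum do rewrite -big_flatten big_flatten_allpairs.
rewrite tree_sum_sum big_seq [RHS]big_seq; apply: eq_bigr => j.
rewrite mem_iota => jp; rewrite tree_sum_sum big_seq [RHS]big_seq.
apply: eq_bigr => i; rewrite mem_iota => ir.
have [||| wf wT lT _] := @treeIII_spec p n r j i _ rpn; [lia | lia | lia |].
by rewrite tree_sum_at ?big_seq1 // wT; lia.
Qed.

Lemma valE T a cs : size cs = weight T ->
  val T (a, cs) = a *: ((-1) ^ ksusp (map gdeg cs) *: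
    treecomp T [seq v q.1 q.2 | q <- zip (arities T) cs] ys b).
Proof. by move=> sz; rewrite /Delta_val conv_termE. Qed.

(** The second desuspension passes the root factor, so [v] or [w] at the root costs a sign and [u]
    does not. *)
Lemma valI j i c1 c2 : (1 <= j <= n)%N -> (1 <= i <= n - j + 1)%N ->
  val (treeI n j i) (1, [:: c1; c2]) =
  (-1) ^ gdeg c1 *: treecomp (treeI n j i) [:: v (n - j + 1) c1; v j c2] ys b.
Proof.
move=> jn ijn; have [wf wT lT aT] := treeI_spec jn ijn.
rewrite /Delta_val conv_termE ?wT // aT /= scale1r !ksusp_cons.
by rewrite mul1r mul0r add0r addr0.
Qed.

Lemma valII k r c : (1 <= k)%N -> r \in compositions k n -> gdeg c = 1 ->
  val (treeII r) ((-1) ^+ (k * (k - 1))./2, gu :: nseq k c) =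
  treecomp (treeII r) (v k gu :: map (v^~ c) r) ys b.
Proof.
move=> k1 rkn c1; have [wf wT lT aT] := treeII_spec k1 rkn.
have fsE : [seq v q.1 q.2 | q <- zip (k :: r) (gu :: nseq k c)] =
    v k gu :: map (v^~ c) r.
  congr (_ :: _); move: rkn; rewrite mem_compositions => /andP[/eqP<- _].
  by elim: r {wf wT lT aT} => //= a r ->.
rewrite valE; last by rewrite /= size_nseq wT.
rewrite aT fsE map_cons map_nseq c1.
rewrite ksusp_cons mulr0 add0r ksusp_nseq1 exprnP scalerA -signzD.
by rewrite (@signz_even _ _ 0 (Posz (k * (k - 1))./2)) ?scale1r; last by ring.
Qed.

(** The root has degree 1 and [p] desuspensions pass it, [u_p] is free, and the [p - 1] remaining
    factors of degree 1 give [binom(p-1, 2)]. The sum [p + binom(p-1, 2)] equals [binom(p, 2) + 1],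
    one more than the exponent in [Delta]. *)
Lemma valIII p (r : seq nat) j i c : (1 <= p)%N -> r \in compositions p n ->
  (1 <= j <= p)%N -> (1 <= i <= part r 1)%N -> gdeg c = 1 ->
  val (treeIII r j i) ((-1) ^+ (p * (p - 1))./2,
           [:: c, gu & nseq j.-1 gv ++ nseq (p - j) gw]) =
  - treecomp (treeIII r j i)
      [:: v (part r 1) c, v p gu & map (v^~ gv) (take j.-1 (behead r)) ++
                                   map (v^~ gw) (drop j.-1 (behead r))] ys b.
Proof.
move=> p1 rpn jp ir c1; have [wf wT lT aT] := treeIII_spec p1 rpn jp ir.
have szr : size (behead r) = p.-1.
  by move: rpn; rewrite mem_compositions size_behead => /andP[/eqP-> _].
have szc : (size (nseq j.-1 gv ++ nseq (p - j) gw) = p.-1)%N.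
  by rewrite size_cat !size_nseq; lia.
have fsE : [seq v q.1 q.2 | q <- zip [:: part r 1, p & behead r]
      [:: c, gu & nseq j.-1 gv ++ nseq (p - j) gw]] =
    [:: v (part r 1) c, v p gu & map (v^~ gv) (take j.-1 (behead r)) ++
                                 map (v^~ gw) (drop j.-1 (behead r))].
  rewrite /=; congr [:: _, _ & _].
  have szt : size (take j.-1 (behead r)) = j.-1 by rewrite size_takel // szr; lia.
  have szd : size (drop j.-1 (behead r)) = (p - j)%N by rewrite size_drop szr; lia.
  have -> : zip (behead r) (nseq j.-1 gv ++ nseq (p - j) gw) =
      zip (take j.-1 (behead r)) (nseq j.-1 gv) ++
      zip (drop j.-1 (behead r)) (nseq (p - j) gw).
    by rewrite -zip_cat ?cat_take_drop // size_nseq.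
  rewrite map_cat -{2}szt -szd; congr (_ ++ _).
    by elim: (take _ _) => //= a l ->.
  by elim: (drop _ _) => //= a l ->.
rewrite valE ?wT; last by rewrite /= szc prednK.
rewrite aT fsE !map_cons map_cat !map_nseq c1.
rewrite !ksusp_cons -nseqD mulr0 mulr1 add0r [size (_ :: _)]/= !size_nseq.
have -> : (j.-1 + (p - j) = p.-1)%N by lia.
rewrite ksusp_nseq1 exprnP scalerA -signzD.
have halfE : ((p * (p - 1))./2 = p.-1 + (p.-1 * (p.-1 - 1))./2)%N.
  by rewrite !subn1 -!bin2 -{1}(prednK p1) binS bin1 addnC.
rewrite (@signz_even _ _ 1 (((p * (p - 1))./2)%:Z)) ?expr1z ?scaleN1r //.
rewrite prednK // halfE -{2 5}(prednK p1); lia.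
Qed.

(** The trees contributing in arity [n] have at most [n + 1] vertices, attained for [k = n] or
    [p = n]; hence the bound [n < N]. *)
Definition MC_val c : susp V b :=
  tree_sum n N (fun T => \sum_(t <- Delta K n T c) val T t).

Lemma MC_val_gu : MC_val gu =
  \sum_(j <- iota 1 n) \sum_(i <- iota 1 (n - j + 1))
    treecomp (treeI n j i) [:: v (n - j + 1) gu; v j gu] ys b.
Proof.
have DE T : Delta K n T gu = DeltaI K n T gu by rewrite -[RHS]cats0.
rewrite /MC_val; under eq_tree_sum do rewrite DE.
rewrite DeltaI_sum big_seq [RHS]big_seq; apply: eq_bigr => j.
rewrite mem_iota => jn; rewrite big_seq [RHS]big_seq; apply: eq_bigr => i.
rewrite mem_iota => ijn; rewrite big_seq1 valI ?expr0z ?scale1r //; lia.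
Qed.

Lemma MC_val_gvw c : c <> gu -> MC_val c =
  - \sum_(i <- iota 1 n) treecomp (treeI n 1 i) [:: v (n - 1 + 1) c; v 1 gu] ys b
  + treecomp (treeI n n 1) [:: v (n - n + 1) gu; v n c] ys b
  + \sum_(k <- iota 2 n.-1) \sum_(r <- compositions k n)
      treecomp (treeII r) (v k gu :: map (v^~ c) r) ys b
  - \sum_(p <- iota 2 n.-1) \sum_(r <- compositions p n)
    \sum_(j <- iota 1 p) \sum_(i <- iota 1 (part r 1))
      treecomp (treeIII r j i)
        [:: v (part r 1) c, v p gu & map (v^~ gv) (take j.-1 (behead r)) ++
                                     map (v^~ gw) (drop j.-1 (behead r))] ys b.
Proof.
move=> cNu; have c1 : gdeg c = 1 by case: c cNu.
rewrite /MC_val /Delta; under eq_tree_sum do rewrite !big_cat /=.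
rewrite !tree_sumD DeltaII_sum // DeltaIII_sum // DeltaI_sum addrA.
congr (_ + _ + _); last first.
- rewrite -sumrN big_seq [RHS]big_seq; apply: eq_bigr => p; rewrite mem_iota => pn.
  rewrite -sumrN big_seq [RHS]big_seq; apply: eq_bigr => r rpn.
  rewrite -sumrN big_seq [RHS]big_seq; apply: eq_bigr => j; rewrite mem_iota => jp.
  rewrite -sumrN big_seq [RHS]big_seq; apply: eq_bigr => i; rewrite mem_iota => ir.
  by rewrite valIII //; lia.
- rewrite big_seq [RHS]big_seq; apply: eq_bigr => k; rewrite mem_iota => kn.
  rewrite big_seq [RHS]big_seq; apply: eq_bigr => r rkn.
  by rewrite valII //; lia.
(* Splitting the two conditions before evaluating them covers [n = 1], where [j = 1] meets both. *)
rewrite (eq_bigr (fun j =>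
   (if j == 1%N then \sum_(i <- iota 1 (n - j + 1))
      val (treeI n j i) (1, [:: c; gu]) else 0) +
   (if j == n then \sum_(i <- iota 1 (n - j + 1))
      val (treeI n j i) (1, [:: gu; c]) else 0))); last first.
  move=> j _; transitivity (\sum_(i <- iota 1 (n - j + 1))
     ((if j == 1%N then val (treeI n j i) (1, [:: c; gu]) else 0) +
      (if j == n then val (treeI n j i) (1, [:: gu; c]) else 0))).
    apply: eq_bigr => i _; case: c cNu {c1} => // _; rewrite big_cat;
    by congr (_ + _); case: ifP; rewrite ?big_nil ?big_seq1.
  by rewrite big_split; congr (_ + _); case: ifP => // _; rewrite big1.
rewrite big_split; congr (_ + _).
  rewrite big_pick ?iota_uniq ?mem_iota //.
  rewrite -sumrN subnK // big_seq [RHS]big_seq; apply: eq_bigr => i.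
  by rewrite mem_iota => ijn; rewrite valI ?c1 ?expr1z ?scaleN1r ?subnK //; lia.
rewrite big_pick ?iota_uniq ?mem_iota //; last by lia.
by rewrite subnn big_seq1 valI ?expr0z ?scale1r ?subnn //; lia.
Qed.

End Delta.

End MaurerCartan.

(** * The exponents [delta] and [eta] in terms of Koszul exponents *)

Lemma ksusp_cat s1 s2 :
  ksusp (s1 ++ s2) = ksusp s1 + ksusp s2 + (size s2)%:Z * \sum_(d <- s1) d.
Proof.
elim: s1 => [|d s1 IH] /=; first by rewrite big_nil mulr0 addr0 add0r.
rewrite !ksusp_cons IH big_cons size_cat PoszD; ring.
Qed.

Lemma ksusp_nseq0 n : ksusp (nseq n 0) = 0.
Proof. by elim: n => // n IH; rewrite ksusp_cons mulr0 add0r. Qed.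

Lemma ksuspE ds :
  ksusp ds = \sum_(0 <= t < size ds) (size ds - t.+1)%:Z * nth 0 ds t.
Proof.
elim: ds => [|d ds IH]; first by rewrite big_geq.
by rewrite ksusp_cons IH big_nat_recl // subn1.
Qed.

Lemma ksusp_sub1 (l : seq nat) :
  ksusp [seq a%:Z - 1 | a <- l] =
  ksusp (map Posz l) - ((size l * (size l - 1))./2)%:Z.
Proof.
rewrite -ksusp_nseq1; elim: l => //= a l IH.
by rewrite !ksusp_cons IH !size_map size_nseq; ring.
Qed.

(** With [ksusp_sub1] this makes [delta], modulo 2, the exponent of moving [s^{(x)k}] past maps of
    degrees [l_t - 1]. *)
Lemma delta_expE (l : seq nat) :
  (delta_exp (size l) l)%:Z =
  ((size l * (size l - 1))./2)%:Z + ksusp (map Posz l).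
Proof.
rewrite /delta_exp PoszD; congr (_ + _); rewrite ksuspE size_map.
rewrite big_add1 /= -natz natr_sum; apply: eq_big_nat => t lt.
by rewrite (nth_map 0%N) // natrM !natz.
Qed.

(** The entries of [ds] are the degrees of the inserted [R] and [S]; positivity of the parts turns
    the truncated differences in [eta_exp] into integer ones. *)
Lemma eta_expE i k j (r : seq nat) : (0 < size r)%N -> all (leq 1) r ->
  (1 <= j <= size r)%N ->
  let ds := [seq a%:Z - 1 | a <- behead r] in
  (eta_exp i k (size r) j r)%:Z =
  i%:Z + ((size r)%:Z + \sum_(d <- ds) d) * k%:Z + \sum_(d <- take j.-1 ds) d
  + ksusp ds.
Proof.
case: r => // a rs _ /andP[_ rs1] /andP[j1 jr] ds.
have szd : size ds = size rs by rewrite size_map.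
have dsE t : (t < size rs)%N -> nth 0 ds t = (nth 0%N rs t - 1)%N%:Z.
  move=> lt; rewrite (nth_map 0%N) //.
  by rewrite -subzn //; apply: (allP rs1); rewrite mem_nth.
have sumE q (G : nat -> nat -> nat) : (q <= size rs)%N ->
    (\sum_(2 <= t < q.+2) G (part (a :: rs) t - 1)%N t)%:Z =
    \sum_(0 <= t < q) (G (nth 0%N rs t - 1)%N t.+2)%:Z.
  move=> qr; rewrite !big_add1 /= -natz natr_sum.
  by apply: eq_bigr => t _; rewrite natz.
have S1 : (\sum_(2 <= t < (size rs).+2) (part (a :: rs) t - 1))%N%:Z =
    \sum_(d <- ds) d.
  rewrite (sumE (size rs) (fun x _ => x)) // [RHS](big_nth 0) szd.
  by apply: eq_big_nat => t lt; rewrite dsE.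
have S2 : (\sum_(2 <= t < j.+1) (part (a :: rs) t - 1))%N%:Z =
    \sum_(d <- take j.-1 ds) d.
  rewrite -(prednK j1) (sumE j.-1 (fun x _ => x)); last by move: jr => /=; lia.
  have szt : size (take j.-1 ds) = j.-1.
    by rewrite size_takel // szd; move: jr => /=; lia.
  rewrite [RHS](big_nth 0) szt; apply: eq_big_nat => t lt.
  by rewrite nth_take // dsE //; move: jr => /=; lia.
have S3 : (\sum_(2 <= t < (size rs).+2)
    (part (a :: rs) t - 1) * ((size rs).+1 - t))%N%:Z = ksusp ds.
  rewrite (sumE (size rs) (fun x t => (x * ((size rs).+1 - t))%N)) // ksuspE szd.
  by apply: eq_big_nat => t lt; rewrite dsE // mulrC.
rewrite -S1 -S2 -S3 /eta_exp [size (a :: rs)]/=; lia.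
Qed.

(** [k] is determined by [i] and [j]; on the right [i] is the 1-based grafting position of
    [treeI]. *)
Lemma sum_ijk (W : nmodType) n (G : nat -> nat -> nat -> W) :
  \sum_(i < n.+1) \sum_(j < n.+1)
    \sum_(k < n.+1 | (i + j + k == n)%N && (1 <= j)%N) G i j k =
  \sum_(j <- iota 1 n) \sum_(i <- iota 1 (n - j + 1)) G i.-1 j (n - j - i.-1)%N.
Proof.
rewrite exchange_big /= -(big_mkord xpredT (fun j => \sum_(i < n.+1)
  \sum_(k < n.+1 | (i + j + k == n)%N && (1 <= j)%N) G i j k)).
rewrite big_ltn // big1 ?add0r => [|i _]; last first.
  by rewrite big_pred0 // => k; rewrite ltnn andbF.
rewrite {1}/index_iota subn1 big_seq [RHS]big_seq; apply: eq_bigr => j.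
rewrite mem_iota => /andP[j1 jn].
rewrite -(big_mkord xpredT (fun i =>
  \sum_(k < n.+1 | (i + j + k == n)%N && (1 <= j)%N) G i j k)).
transitivity (\sum_(0 <= i < n - j + 1) G i j (n - j - i)%N); last first.
  have -> : iota 1 (n - j + 1) = index_iota 1 (n - j + 2).
    by rewrite /index_iota; congr iota; lia.
  by rewrite addn2 big_add1 addn1.
rewrite (@big_nat_widen _ _ _ _ (n - j + 1) n.+1) /=; last by lia.
rewrite [RHS]big_mkcond /=; apply: eq_bigr => i _; case: ifP => ij; last first.
  by rewrite big_pred0 // => k; apply/negbTE/negP => /andP[/eqP]; lia.
have kn : (n - j - i < n.+1)%N by lia.
rewrite (big_pred1 (Ordinal kn)) // => k; rewrite j1 andbT.
by apply/eqP/eqP => [?|->] /=; [apply: val_inj => /=; lia | lia].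
Qed.

Lemma compositions1 n : (0 < n)%N -> compositions 1 n = [:: [:: n]].
Proof.
move=> n0; apply: perm_small_eq => //; apply: uniq_perm => //.
  exact: uniq_compositions.
move=> r; rewrite mem_compositions inE; case: r => [|a [|b r]] //=.
  by rewrite addn0 eqseq_cons eqxx !andbT; case: eqP => [->|]; rewrite ?n0 ?andbF.
by rewrite eqseq_cons andbF.
Qed.

Section ListExp.

Variables (K : fieldType) (V : gspace K).
Local Notation sV := (susp V).

(** The [k] suspensions to the right of the insertion pass [P], and [Q] passes the [i] suspensions
    to its left. *)
Lemma list_exp_insert i k (P : op V V) (Q : op sV sV) :
  list_exp (nseq i (idop V) ++ P :: nseq k (idop V))
           (nseq i (idop sV) ++ Q :: nseq k (idop sV)) =
  k%:Z * odg P + i%:Z * odg Q.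
Proof.
have sum0 m : \sum_(d <- nseq m (0 : int)) d = 0.
  by rewrite big1_seq // => d; rewrite mem_nseq => /andP[_ /andP[_ /eqP]].
rewrite /list_exp -(size_map (@odg K V V)) -/(ksusp _) !map_cat /= !map_nseq /=.
congr (_ + _).
  rewrite ksusp_cat ksusp_cons !ksusp_nseq0 size_nseq sum0; ring.
elim: i => [|i IH] /=; first by rewrite kexp_nseq0 sum0; ring.
by rewrite IH big_cat big_cons /= !sum0 intS; ring.
Qed.

Lemma list_exp_deg0 Ps (Qs : seq (op sV sV)) : all (pred1 0) (map (@odg K sV sV) Qs) ->
  list_exp Ps Qs = ksusp (map (@odg K V V) Ps).
Proof.
by move/all_pred1P=> odg0; rewrite /list_exp odg0 kexp_nseq0 addr0 /ksusp size_map.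
Qed.

Lemma desus_insert e e' i k P P' Q Q' : scalable_op Q ->
  desuspends e P Q -> desuspends e' P' Q' -> oar Q = (i + 1 + k)%N ->
  desuspends (e + e' + (k%:Z * odg P' + i%:Z * odg Q'))
    (gcomp P (nseq i (idop V) ++ P' :: nseq k (idop V)))
    (gcomp Q (nseq i (idop sV) ++ Q' :: nseq k (idop sV))).
Proof.
move=> QZ dQ dQ' arQ; rewrite -list_exp_insert; apply: desus_gcomp => //.
  by rewrite size_cat /= !size_nseq arQ; lia.
rewrite -[e']add0r; apply: desus_cat; first exact/desus_nseq/desus_idop.
by rewrite -[e']addr0; constructor=> //; exact/desus_nseq/desus_idop.
Qed.

(** When the prescribed exponent [d] agrees with [e] modulo 2, only a sign depending on the
    arguments alone is left, and it factors out of the whole equation. *)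
Lemma desus_sign e (d : nat) P Q ys b c : desuspends e P Q ->
  d%:Z + e = 2 * c ->
  (-1) ^+ d *: P (map (@desusp_elem K V) ys) (b - 1) =
    (-1) ^ susp_exp ys *: Q ys b.
Proof.
case=> _ _ val de; rewrite val scalerA exprnP -signzD; congr (_ *: _).
by apply: (@signz_even _ _ _ c); rewrite addrA de addrC.
Qed.

End ListExp.


(** * Comparison of the two systems of equations *)

Section Comparison.

Variables (K : fieldType) (V : gspace K) (phi : welem V 0) (F : hrbs_data V).
Hypothesis cF : corresponds phi F.

Local Notation sV := (susp V).
Local Notation Phi := (existT _ 0 phi : whomog V).
Local Notation v := (wop Phi).
Local Notation h := (hrbs_op F).
Local Notation dn := (@desusp_elem K V).
Local Notation full c l := (gcomp (v l c) (nseq l (idop sV))).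

Lemma wop_scalable l c : scalable_op (v l c).
Proof. exact: gmap_scalable. Qed.

Lemma oar_wop l c : (0 < l)%N -> oar (v l c) = l.
Proof. by case: l. Qed.

Lemma odg_wop l c : odg (v l c) = gdeg c - 1.
Proof. by rewrite /= addr0. Qed.

Lemma odg_full l c : odg (full c l) = gdeg c - 1.
Proof.
rewrite /= big_nseq !addr0; elim: l => [|l IH] /=; first by rewrite addr0.
by rewrite add0r.
Qed.

Lemma desus_full l c : (0 < l)%N -> desuspends 0 (h c l) (full c l).
Proof.
move=> l0; have := desus_corolla (desus_hrbs c l cF) (@gmap_supported _ _ _ _ _ _).
by rewrite oar_wop.
Qed.

Lemma odg_hrbs c l : (0 < l)%N -> c <> gu -> odg (h c l) = l%:Z - 1.
Proof. by case: l => // l _; case: c. Qed.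

Lemma odg_hrbs_gu l : (0 < l)%N -> odg (h gu l) = l%:Z - 2.
Proof. by case: l. Qed.

Lemma stasheff_term n j i k ys b : (0 < j)%N -> (i + j + k = n)%N ->
  (-1) ^+ (i + j * k) *:
    gcomp (mop F (i + 1 + k)) (nseq i (idop V) ++ mop F j :: nseq k (idop V))
      (map dn ys) (b - 1) =
  (-1) ^ susp_exp ys *:
    treecomp (treeI n j i.+1) [:: v (n - j + 1) gu; v j gu] ys b.
Proof.
move=> j0 nE; rewrite treecomp_treeI.
have -> : (n - j + 1 = i + 1 + k)%N by lia.
have -> : (i + 1 + k - i.+1 = k)%N by lia.
have dT := desus_insert (@wop_scalable _ gu) (desus_hrbs gu (i + 1 + k) cF)
  (desus_full gu j0) (oar_wop gu (_ : 0 < i + 1 + k)%N).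
(* The insertion costs [k(j - 2) - i]; adding [i + jk] gives [2(jk - k)]. *)
apply: (desus_sign (c := j%:Z * k%:Z - k%:Z) _ _ (dT _)); first by lia.
rewrite odg_hrbs_gu // odg_full /= PoszD PoszM; ring.
Qed.

Lemma desus_map_full (r : seq nat) c : all (leq 1) r ->
  desuspends_list 0 (map (h c) r) (map (fun l => full c l) r).
Proof.
by move=> /allP r1; apply: desus_map => l /r1; exact: desus_full.
Qed.

Lemma odg_map_hrbs (r : seq nat) c : all (leq 1) r -> c <> gu ->
  map (@odg K V V) (map (h c) r) = [seq l%:Z - 1 | l <- r].
Proof.
move=> /allP r1 cNu; rewrite -map_comp; apply/eq_in_map => l /r1 l1 /=.
exact: odg_hrbs.
Qed.

Lemma odg_map_full (r : seq nat) c : gdeg c = 1 ->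
  all (pred1 0) (map (@odg K sV sV) (map (fun l => full c l) r)).
Proof.
move=> c1; rewrite -map_comp all_map; apply/allP => l _.
by apply/eqP; rewrite [LHS]odg_full c1.
Qed.

Lemma product_term c k n (r : seq nat) ys b : c <> gu -> (0 < k)%N ->
  r \in compositions k n ->
  (-1) ^+ delta_exp k r *: gcomp (mop F k) (map (h c) r) (map dn ys) (b - 1) =
  (-1) ^ susp_exp ys *: treecomp (treeII r) (v k gu :: map (v^~ c) r) ys b.
Proof.
move=> cNu k0; rewrite mem_compositions => /and3P[/eqP kE r1 _].
have c1 : gdeg c = 1 by case: c cNu.
rewrite treecomp_treeII.
have dT := desus_gcomp (@wop_scalable k gu) (desus_hrbs gu k cF).
have {}dT := dT _ _ _ _ (desus_map_full c r1).
(* The two occurrences of [k(k-1)/2], from [delta_expE] and [ksusp_sub1], cancel and leave twice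
   [ksusp] of the arities. *)
apply: (desus_sign (c := ksusp (map Posz r)) _ _ (dT _)).
  by rewrite oar_wop // size_map kE.
rewrite list_exp_deg0 ?odg_map_full // odg_map_hrbs // ksusp_sub1 -kE delta_expE; ring.
Qed.

(** Origin of [eta]: the inner composite costs [ksusp] of the degrees [r_t - 1], plus the degrees of
    the [R] factors once more, since the identity adds a slot to their right. Inserting it, with
    degree [p - 2 + sum (r_t - 1)] on [V] and -1 on [sV], contributes the terms in [k] and [i]. *)
Lemma insertion_term c n p j (r : seq nat) i ys b : c <> gu -> (0 < p)%N ->
  r \in compositions p n -> (1 <= j <= p)%N -> (i < part r 1)%N ->
  (-1) ^+ eta_exp i (part r 1 - 1 - i) p j r *:
    gcomp (h c (part r 1))
      (nseq i (idop V) ++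
       gcomp (mop F p) (map (Rop F) (take j.-1 (behead r)) ++
                        idop V :: map (Sop F) (drop j.-1 (behead r)))
       :: nseq (part r 1 - 1 - i) (idop V)) (map dn ys) (b - 1) =
  (-1) ^ susp_exp ys *:
    treecomp (treeIII r j i.+1)
      [:: v (part r 1) c, v p gu & map (v^~ gv) (take j.-1 (behead r)) ++
                                   map (v^~ gw) (drop j.-1 (behead r))] ys b.
Proof.
move=> cNu p0; rewrite mem_compositions => /and3P[/eqP pE r1 _] jp ir.
rewrite treecomp_treeIII -subnDA add1n [i.+1.-1]/=; set k := (part r 1 - i.+1)%N.
have r0 : (0 < part r 1)%N by lia.
have rs1 : all (leq 1) (behead r) by case: (r) r1 => //= a rs /andP[].
have /andP[rt1 rd1] : all (leq 1) (take j.-1 (behead r)) &&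
    all (leq 1) (drop j.-1 (behead r)) by rewrite -all_cat cat_take_drop.
have dinner := desus_gcomp (@wop_scalable p gu) (desus_hrbs gu p cF) _
  (desus_cat (desus_map_full gv rt1)
     (Desus_cons (desus_idop V) (desus_map_full gw rd1))).
have sz : (size (take j.-1 (behead r)) + size (drop j.-1 (behead r)))%N = p.-1.
  by rewrite -size_cat cat_take_drop size_behead pE.
have {}dinner := dinner _.
rewrite oar_wop // size_cat /= !size_map addnS sz prednK // in dinner.
have {}dinner := dinner erefl.
have dT := desus_insert (@wop_scalable (part r 1) c)
  (desus_hrbs c (part r 1) cF) dinner.
have {}dT := dT i k; rewrite oar_wop // in dT.
set ds := [seq l%:Z - 1 | l <- behead r].
apply: (desus_sign (c := (p%:Z + \sum_(d <- ds) d) * k%:Z - k%:Z +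
  \sum_(d <- take j.-1 ds) d + ksusp ds) _ _ (dT _)); first by rewrite /k; lia.
rewrite list_exp_deg0; last first.
  by rewrite map_cat all_cat /= !odg_map_full.
rewrite map_cat map_cons (@odg_map_hrbs _ gv) // (@odg_map_hrbs _ gw) //.
have dsE : ds = [seq l%:Z - 1 | l <- take j.-1 (behead r)] ++
                [seq l%:Z - 1 | l <- drop j.-1 (behead r)].
  by rewrite -map_cat cat_take_drop.
have dtE : [seq l%:Z - 1 | l <- take j.-1 (behead r)] = take j.-1 ds.
  by rewrite map_take.
have sum_odg (W U : gspace K) (gs : seq (op W U)) :
    \sum_(g <- gs) odg g = \sum_(d <- map (@odg K W U) gs) d by rewrite big_map.
have -> : odg (gcomp (mop F p)
    ([seq Rop F l | l <- take j.-1 (behead r)] ++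
     idop V :: [seq Sop F l | l <- drop j.-1 (behead r)])) =
    p%:Z - 2 + \sum_(d <- ds) d.
  rewrite -(odg_hrbs_gu p0); congr (_ + _); rewrite sum_odg map_cat map_cons.
  rewrite (@odg_map_hrbs _ gv) // (@odg_map_hrbs _ gw) // dsE !big_cat big_cons.
  by rewrite /= add0r.
have -> : odg (gcomp (v p gu)
    ([seq full gv l | l <- take j.-1 (behead r)] ++
     idop sV :: [seq full gw l | l <- drop j.-1 (behead r)])) = -1.
  rewrite -[RHS](odg_wop p gu) -[RHS]addr0; congr (_ + _); rewrite sum_odg.
  rewrite big1_seq // => d /andP[_]; rewrite map_cat mem_cat inE.
  by case/or3P => [/(allP (odg_map_full _ (erefl (gdeg gv))))/eqP|/eqP
    |/(allP (odg_map_full _ (erefl (gdeg gw))))/eqP].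
have ksds : ksusp ds = ksusp (take j.-1 ds)
    + ksusp [seq l%:Z - 1 | l <- drop j.-1 (behead r)]
    + (size (drop j.-1 (behead r)))%:Z * \sum_(d <- take j.-1 ds) d.
  by rewrite {1}dsE ksusp_cat dtE size_map.
have := @eta_expE i k j r; rewrite pE /= -/ds => -> //.
rewrite ksusp_cat ksusp_cons dtE /= size_map intS ksds; ring.
Qed.


Lemma stasheff_MC n N ys b : (0 < n)%N -> (n < N)%N ->
  \sum_(i < n.+1) \sum_(j < n.+1) \sum_(k < n.+1 | (i + j + k == n)%N && (1 <= j)%N)
    (-1) ^+ (i + j * k)
      *: gcomp (mop F (i + 1 + k)%N)
           (nseq i (idop V) ++ mop F j :: nseq k (idop V)) (map dn ys) (b - 1)
  = (-1) ^ susp_exp ys *: MC_val phi n N ys b gu.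
Proof.
move=> n0 nN; rewrite (sum_ijk n (fun i j k => (-1) ^+ (i + j * k)
      *: gcomp (mop F (i + 1 + k)%N)
           (nseq i (idop V) ++ mop F j :: nseq k (idop V)) (map dn ys) (b - 1))).
rewrite MC_val_gu // scaler_sumr big_seq [RHS]big_seq; apply: eq_bigr => j.
rewrite mem_iota => jn; rewrite scaler_sumr big_seq [RHS]big_seq.
apply: eq_bigr => i; rewrite mem_iota => /andP[i1 ijn].
rewrite (@stasheff_term n j i.-1 (n - j - i.-1) ys b) ?prednK //; lia.
Qed.

(** The type I terms are the members [k = 1] and [p = 1] of the families II and
    III. *)
Lemma MC_val_uniform c n N ys b : (0 < n)%N -> (n < N)%N -> c <> gu ->
  MC_val phi n N ys b c =
  \sum_(k <- iota 1 n) \sum_(r <- compositions k n)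
    treecomp (treeII r) (v k gu :: map (v^~ c) r) ys b
  - \sum_(p <- iota 1 n) \sum_(r <- compositions p n)
    \sum_(j <- iota 1 p) \sum_(i <- iota 1 (part r 1))
      treecomp (treeIII r j i)
        [:: v (part r 1) c, v p gu & map (v^~ gv) (take j.-1 (behead r)) ++
                                     map (v^~ gw) (drop j.-1 (behead r))] ys b.
Proof.
move=> n0 nN cNu; rewrite MC_val_gvw //.
have II1 : \sum_(r <- compositions 1 n)
      treecomp (treeII r) (v 1 gu :: map (v^~ c) r) ys b =
    treecomp (treeI n n 1) [:: v (n - n + 1) gu; v n c] ys b.
  by rewrite compositions1 // big_seq1 subnn /treeI /treeII !subnn.
have III1 : \sum_(r <- compositions 1 n)
    \sum_(j <- iota 1 1) \sum_(i <- iota 1 (part r 1))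
      treecomp (treeIII r j i)
        [:: v (part r 1) c, v 1 gu & map (v^~ gv) (take j.-1 (behead r)) ++
                                     map (v^~ gw) (drop j.-1 (behead r))] ys b =
    \sum_(i <- iota 1 n) treecomp (treeI n 1 i) [:: v (n - 1 + 1) c; v 1 gu] ys b.
  rewrite compositions1 // !big_seq1; apply: eq_bigr => i _.
  by rewrite /treeI /treeIII subnK.
have iotaS (G : nat -> sV b) :
    \sum_(k <- iota 1 n) G k = G 1%N + \sum_(k <- iota 2 n.-1) G k.
  by rewrite -{1}(prednK n0) big_cons.
rewrite [X in _ = X - _]iotaS [X in _ = _ - X]iotaS II1 III1.
by rewrite opprD !addrA; congr (_ - _); rewrite -addrA addrC.
Qed.

Lemma rb_MC c n N ys b : (0 < n)%N -> (n < N)%N -> c <> gu ->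
  \sum_(1 <= k < n.+1) \sum_(l <- compositions k n)
    (-1) ^+ delta_exp k l *: gcomp (mop F k) (map (h c) l) (map dn ys) (b - 1)
  - (\sum_(1 <= p < n.+1) \sum_(1 <= j < p.+1) \sum_(r <- compositions p n)
      \sum_(i < part r 1)
        let k := (part r 1 - 1 - i)%N in
        let inner :=
          gcomp (mop F p) (map (Rop F) (take j.-1 (behead r)) ++
                      idop V :: map (Sop F) (drop j.-1 (behead r))) in
        (-1) ^+ eta_exp i k p j r
          *: gcomp (h c (part r 1))
               (nseq i (idop V) ++ inner :: nseq k (idop V)) (map dn ys) (b - 1))
  = (-1) ^ susp_exp ys *: MC_val phi n N ys b c.
Proof.
move=> n0 nN cNu; rewrite MC_val_uniform // scalerBr !scaler_sumr.
have iotaE q : index_iota 1 q.+1 = iota 1 q by rewrite /index_iota subn1.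
rewrite !iotaE; congr (_ - _); rewrite big_seq [RHS]big_seq; apply: eq_bigr => k.
  rewrite mem_iota => kn; rewrite scaler_sumr big_seq [RHS]big_seq.
  by apply: eq_bigr => r rkn; rewrite (@product_term c k n) //; lia.
rewrite mem_iota => pn; rewrite iotaE exchange_big scaler_sumr /=.
rewrite big_seq [RHS]big_seq; apply: eq_bigr => r rpn; rewrite scaler_sumr.
rewrite big_seq [RHS]big_seq; apply: eq_bigr => j; rewrite mem_iota => jp.
rewrite scaler_sumr -iotaE big_add1 big_mkord; apply: eq_bigr => i _.
by rewrite (@insertion_term c n) //; lia.
Qed.

Lemma hrbs_MC : [pchar K] =i pred0 -> is_hrbs F <-> is_MC phi.
Proof.
move=> K0; split=> [[st rbR rbS] n c n0|mc].
  exists n.+1 => N nN ys b; rewrite lambda_sum //.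
  suff : (-1) ^ susp_exp ys *: MC_val phi n N ys b c = 0.
    move/eqP; rewrite scaler_eq0 (negbTE (signz_neq0 K _)) /= => /eqP mc0.
    by apply/eqP; rewrite oppr_eq0; apply/eqP.
  case: c; first by rewrite -stasheff_MC // st.
    by rewrite -rb_MC //; apply/eqP; rewrite subr_eq0; apply/eqP; exact: rbR.
  by rewrite -rb_MC //; apply/eqP; rewrite subr_eq0; apply/eqP; exact: rbS.
have mc0 n c : (0 < n)%N ->
    exists2 N, (n < N)%N & forall ys b, MC_val phi n N ys b c = 0.
  move=> n0; have [M mcM] := mc n c n0; exists (maxn M n.+1); first by lia.
  move=> ys b; apply/eqP; rewrite -oppr_eq0; apply/eqP.
  by rewrite -[RHS](mcM (maxn M n.+1) (leq_maxl _ _) ys b) lambda_sum.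
have rb c : c <> gu -> rb_identity (mop F) (Rop F) (Sop F) (h c).
  move=> cNu n n0 xs b; have [N nN MC0] := mc0 n c n0.
  have [ys <-] := map_dn_surj xs; have [b' ->] := int_shift b.
  by apply/eqP; rewrite -subr_eq0; apply/eqP; rewrite (rb_MC _ _ n0 nN) // MC0 scaler0.
split; [move=> n n0 xs b | exact: (rb gv) | exact: (rb gw)].
have [N nN MC0] := mc0 n gu n0.
have [ys <-] := map_dn_surj xs; have [b' ->] := int_shift b.
by rewrite (stasheff_MC _ _ n0 nN) MC0 scaler0.
Qed.

End Comparison.

(** * Degree zero *)

Section DegreeZero.

Variables (K : fieldType) (V : gspace K) (F : hrbs_data V).
Hypotheses (V0 : concentrated_in_degree0 V) (hF : is_hrbs F).

Local Notation el := (@Homog K V 0).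
Local Notation mu := (fun a b : V 0 => mop F 2 [:: el a; el b] 0).

Lemma sdeg_deg0 (s : seq (V 0)) : sdeg (map el s) = 0.
Proof. by elim: s => [|x s IH]; rewrite ?sdeg_nil //= sdeg_cons IH. Qed.

(** Arguments of degree 0 produce no Koszul sign, and each inner output sits in the degree of its
    operation. *)
Lemma gcomp_deg0 (f : op V V) gs (s : seq (V 0)) b :
  size s = sumn (map (@oar K V V) gs) ->
  gcomp f gs (map el s) b =
  f [seq Homog (oval p.1 (map el p.2) (odg p.1))
    | p <- zip gs (reshape (map (@oar K V V) gs) s)] b.
Proof.
move=> sz; rewrite /= size_map sz eqxx -map_reshape.
move: (reshape _ _) => r {sz}.
have -> : kexp (map (@odg K V V) gs) (map (@sdeg K V) (map (map el) r)) = 0.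
  elim: gs r => [|g gs IH] [|y ys] //=.
  by rewrite IH sdeg_deg0 mulr0.
rewrite expr0z scale1r; congr (f _ b).
elim: gs r => [|g gs IH] [|y ys] //=.
by rewrite IH sdeg_deg0 add0r.
Qed.

Lemma gmap_deg0 n d (f : gmap V V n d) e (u : V e) xs ys b : e != 0 ->
  gval f (xs ++ Homog u :: ys) b = 0.
Proof. by move=> e0; rewrite (V0 e0 u) gmap_linear0. Qed.

Lemma mu_assoc : associative mu.
Proof.
move=> x y z /=.
have [st _ _] := hF; have := st 3%N isT (map el [:: x; y; z]) 0.
rewrite (sum_ijk 3 (fun i j k => (-1) ^+ (i + j * k)
  *: gcomp (mop F (i + 1 + k)%N) (nseq i (idop V) ++ mop F j :: nseq k (idop V))
       (map el [:: x; y; z]) 0)).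
rewrite !big_cons !big_nil !gcomp_deg0 //= !hcompE.
(* The three terms with [j = 1] contain an output of [m_1] in degree -1, and the term with [j = 3]
   one of [m_3] in degree 1; only the two products of [m_2] survive. *)
rewrite (@gmap_deg0 _ _ _ (1%Z - 2) _ [::]) //.
rewrite (@gmap_deg0 _ _ _ (1%Z - 2) _ [:: _]) //.
rewrite (@gmap_deg0 _ _ _ (1%Z - 2) _ [:: _; _]) //.
rewrite (@gmap_deg0 _ _ _ (3%Z - 2) _ [::]) //.
rewrite !scaler0 !add0r !addr0 expr1 sqrrN expr1n scale1r scaleN1r => /eqP.
by rewrite subr_eq0 => /eqP.
Qed.

(** Disposes of the terms [p = 1] in arity 2: [m_1] lands in degree -1, where [V] vanishes. The two
    cases are the two insertion positions. *)
Lemma insert_arity2_deg0 (X2 : gmap V V 2 1) (l1 l2 : seq (op V V)) s b :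
  (l1 = [:: idop V] /\ l2 = [::]) \/ (l1 = [::] /\ l2 = [:: idop V]) ->
  size s = 2%N ->
  gcomp X2 (l1 ++ gcomp (mop F 1) [:: idop V] :: l2) (map el s) b = 0.
Proof.
have inner_odg : odg (gcomp (mop F 1) [:: idop V]) != 0 by rewrite /= big_seq1.
case: s => [|x [|y [|? ?]]] //.
case=> -[-> ->] _; rewrite gcomp_deg0 //.
  exact: (@gmap_deg0 _ _ X2 _ _ [:: Homog (idop V [:: el x] 0)] [::] _ inner_odg).
exact: (@gmap_deg0 _ _ X2 _ _ [::] [:: Homog (idop V [:: el y] 0)] _ inner_odg).
Qed.

Lemma insert_product_deg0 (X1 : gmap V V 1 0) (f g : op V V) x y :
  oar f = 1%N -> oar g = 1%N -> odg f = 0 -> odg g = 0 ->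
  gcomp X1 [:: gcomp (mop F 2) [:: f; g]] (map el [:: x; y]) 0 =
  X1 [:: el (mu (f [:: el x] 0) (g [:: el y] 0))] 0.
Proof.
move=> f1 g1 f0 g0.
have inner_odg : odg (gcomp (mop F 2) [:: f; g]) = 0.
  by rewrite /= !big_cons big_nil f0 g0.
rewrite gcomp_deg0; last by rewrite /= f1 g1.
rewrite [map (@oar K V V) _]/= f1 g1.
rewrite -[LHS]/(X1 [:: Homog (gcomp (mop F 2) [:: f; g] (map el [:: x; y])
  (odg (gcomp (mop F 2) [:: f; g])))] 0).
by rewrite inner_odg gcomp_deg0 /= f1 g1 ?f0 ?g0.
Qed.

(** This is the arity 2 identity. [X] is given through [gmap]s because linearity of [X_1] merges the
    summands [j = 1] and [j = 2] at the end. *)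
Lemma rb_deg0 (hX : forall n, gmap V V n.+1 (n.+1%:Z - 1)) :
  let X n : op V V := hX n.-1 in rb_identity (mop F) (Rop F) (Sop F) X ->
  forall a b, mu (X 1%N [:: el a] 0) (X 1%N [:: el b] 0) =
    X 1%N [:: el (mu (Rop F 1 [:: el a] 0) b + mu a (Sop F 1 [:: el b] 0))] 0.
Proof.
move=> X rbX a b; have := rbX 2%N isT (map el [:: a; b]) 0.
have big_nat_13 (G : nat -> V 0) : \sum_(1 <= k < 3) G k = G 1%N + G 2%N.
  by rewrite big_ltn // big_nat1.
rewrite !big_nat_13 !big_nat1 -[compositions 1 2]/[:: [:: 2]]%N.
rewrite -[compositions 2 2]/[:: [:: 1; 1]]%N !big_seq1.
rewrite [\sum_(i < part [:: 2]%N 1) _](big_ord_recl 1) !big_ord1.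
rewrite (@insert_arity2_deg0 (hX 1%N) [::] [:: idop V]) //; last by right.
rewrite (@insert_arity2_deg0 (hX 1%N) [:: idop V] [::]) //; last by left.
rewrite !scaler0 !add0r.
(* [X_2] has degree 1, so [m_1] is applied to an element of [V 1], which is 0. *)
have -> : gcomp (mop F 1) (map X [:: 2%N]) (map el [:: a; b]) 0 = 0.
  by rewrite gcomp_deg0 //; exact: (@gmap_deg0 _ _ _ (2%Z - 1) _ [::]).
have -> : gcomp (mop F 2) (map X [:: 1; 1]%N) (map el [:: a; b]) 0 =
    mu (X 1%N [:: el a] 0) (X 1%N [:: el b] 0) by rewrite gcomp_deg0.
have -> : delta_exp 2 [:: 1; 1]%N = 2%N.
  by rewrite /delta_exp big_ltn // big_nat1.
rewrite scaler0 add0r sqrrN expr1n scale1r => ->.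
have etaE j : eta_exp 0 0 2 j [:: 1; 1]%N = 0%N.
  have p0 t : (part [:: 1; 1] t - 1 = 0)%N.
    by case: t => [|[|[|t]]] //; rewrite /part /= nth_nil.
  rewrite /eta_exp !big1 //= => t _; by rewrite p0.
have unsign j (z : V 0) : (-1) ^+ eta_exp 0 0 2 j [:: 1; 1]%N *: z = z.
  by rewrite etaE scale1r.
(* For [j = 1] the identity is paired with [S] on its right, for [j = 2] with [R] on its left. *)
transitivity (X 1%N [:: el (mu (idop V [:: el a] 0) (Sop F 1 [:: el b] 0))] 0 +
              X 1%N [:: el (mu (Rop F 1 [:: el a] 0) (idop V [:: el b] 0))] 0).
  congr (_ + _); apply: (etrans (unsign _ _)); exact: insert_product_deg0.
rewrite [idop V [:: el a] 0]hcompE [idop V [:: el b] 0]hcompE addrC.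
have := gval_linear (hX 0%N) [::] [::] 1
  (mu (Rop F 1 [:: el a] 0) b) (mu a (Sop F 1 [:: el b] 0)) 0.
by rewrite !scale1r => lin; rewrite [RHS]lin.
Qed.

Lemma rb_system_deg0 :
  is_rb_system mu (fun a => Rop F 1 [:: el a] 0) (fun a => Sop F 1 [:: el a] 0).
Proof.
have [_ rbR rbS] := hF; split; [split | split | exact: (@rb_deg0 (hR F)) |].
- by move=> a x y z; exact: (gval_linear (hm F 1) [::]).
- by move=> a x y z; exact: (gval_linear (hm F 1) [:: _]).
- exact: mu_assoc.
- by move=> a x y; exact: (gval_linear (hR F 0) [::]).
- by move=> a x y; exact: (gval_linear (hS F 0) [::]).
- exact: (@rb_deg0 (hS F)).
Qed.

End DegreeZero.

Theorem proposition5p2 (K : fieldType) (charK0 : [pchar K] =i pred0)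
    (V : gspace K) :
  [/\ (forall phi : welem V 0, exists! F : hrbs_data V, corresponds phi F) /\
      (forall F : hrbs_data V, exists! phi : welem V 0, corresponds phi F),
      (forall (phi : welem V 0) (F : hrbs_data V),
         corresponds phi F -> (is_hrbs F <-> is_MC phi))
    & (concentrated_in_degree0 V ->
       forall (phi : welem V 0) (F : hrbs_data V),
         corresponds phi F -> is_MC phi ->
         is_rb_system
           (fun a b : V 0 => mop F 2 [:: Homog a; Homog b] 0)
           (fun a : V 0 => Rop F 1 [:: Homog a] 0)
           (fun a : V 0 => Sop F 1 [:: Homog a] 0))].
Proof.
split; first by split; [exact: desusp_unique | exact: susp_unique].
  by move=> phi F cF; exact: hrbs_MC.
move=> V0 phi F cF mc; apply: rb_system_deg0 => //.
exact/(hrbs_MC cF charK0).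
Qed.
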